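(* Let $t\geq 4$ be an integer, let $\mathcal{H}=\mathrm{Forb}(K_{2,t})$, and let $p\in[0,1]$ satisfy $p\geq \frac{2}{t+1}$. Then $$\mathrm{ed}_{\mathcal{H}}(p)=\frac{1-p}{t-1}.$$
   Context: All graphs are finite and simple. $K_{2,t}$ is the complete bipartite graph with parts of sizes $2$ and $t$. For a graph $H$, $\mathrm{Forb}(H)$ is the hereditary property consisting of all graphs with no induced subgraph isomorphic to $H$. For graphs $G,G'$ on the same labeled vertex set, $\mathrm{dist}(G,G')=|E(G)\,\Delta\, E(G')|$; for a hereditary property $\mathcal{H}$ (a set of graphs closed under isomorphism and vertex deletion), $\mathrm{dist}(G,\mathcal{H})=\min\{\mathrm{dist}(G,G'): G'\in\mathcal{H},\ V(G')=V(G)\}$. The edit distance function is $$\mathrm{ed}_{\mathcal{H}}(p)=\lim_{n\to\infty}\max\left\{\mathrm{dist}(G,\mathcal{H}): |V(G)|=n,\ |E(G)|=\left\lfloor p\tbinom n2\right\rfloor\right\}\Big/\tbinom n2,\qquad p\in[0,1].$$ (The limit is known to exist, and the function is known to be continuous and concave.) *)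

(* Defs.v *)
From HB Require Import structures.
From mathcomp Require Import all_boot all_order all_algebra.
Set Implicit Arguments.
Unset Strict Implicit.
Unset Printing Implicit Defensive.
Import Order.TTheory GRing.Theory Num.Theory.

Local Open Scope ring_scope.

(* Simple graphs with vertex set the whole finite type T, given by their set of
   edges; T plays the role of the set of labels. *)
Record sgraph (T : finType) := SGraph {
  edges : {set {set T}};
  edgesP : edges \subset [set e : {set T} | #|e| == 2%N]
}.

HB.instance Definition _ (T : finType) := [isSub for @edges T].
HB.instance Definition _ (T : finType) := [Finite of sgraph T by <:].

(* For x = y this is false, since [set x; x] is a singleton. *)
Definition adj (T : finType) (G : sgraph T) (x y : T) : bool :=
  [set x; y] \in edges G.

Definition isomorphic (S T : finType) (G : sgraph S) (H : sgraph T) : bool :=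
  [exists f : {ffun S -> T},
    [&& #|S| == #|T|, injectiveb f &
        [forall x, forall y, adj H (f x) (f y) == adj G x y]]].

Lemma induced_subproof (T : finType) (G : sgraph T) (A : {set T}) :
  [set e : {set {x : T | x \in A}} | val @: e \in edges G]
    \subset [set e : {set {x : T | x \in A}} | #|e| == 2%N].
Proof.
apply/subsetP => e; rewrite !inE => /(subsetP (edgesP G)).
by rewrite inE card_imset //; exact: val_inj.
Qed.

Definition induced (T : finType) (G : sgraph T) (A : {set T}) :
  sgraph {x : T | x \in A} := SGraph (induced_subproof G A).

Record hereditary := Hereditary {
  hprop :> forall T : finType, sgraph T -> bool;
  hprop_iso : forall (S T : finType) (G : sgraph S) (H : sgraph T),
    isomorphic G H -> hprop G -> hprop H;
  hprop_del : forall (T : finType) (G : sgraph T) (v : T),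
    hprop G -> hprop (induced G [set~ v])
}.

Definition has_induced (S T : finType) (H : sgraph S) (G : sgraph T) : bool :=
  [exists A : {set T}, isomorphic H (induced G A)].

Lemma adj_induced (T : finType) (G : sgraph T) (A : {set T})
  (x y : {x : T | x \in A}) : adj (induced G A) x y = adj G (val x) (val y).
Proof. by rewrite /adj inE imsetU !imset_set1. Qed.

Lemma has_inducedP (S T : finType) (H : sgraph S) (G : sgraph T) :
  reflect (exists2 f : S -> T, injective f &
             forall x y, adj G (f x) (f y) = adj H x y)
          (has_induced H G).
Proof.
apply: (iffP existsP) => [[A /existsP[f /and3P[_ /injectiveP fI /forallP fE]]]|].
  exists (fun x => val (f x)) => [x y /val_inj/fI//|x y].
  by have /forallP/(_ y)/eqP <- := fE x; rewrite adj_induced.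
case=> f fI fE; exists [set f x | x in S]; apply/existsP.
have fA x : f x \in [set f x | x in S] by apply/imsetP; exists x.
exists [ffun x => exist _ (f x) (fA x)]; apply/and3P; split.
- by rewrite card_sig -(card_imset S fI); apply/eqP/eq_card => z; rewrite !inE.
- by apply/injectiveP => x y; rewrite !ffunE => -[] /fI.
- apply/forallP => x; apply/forallP => y.
  by rewrite adj_induced !ffunE /= fE.
Qed.

Definition forb_prop (S : finType) (H : sgraph S) (T : finType) (G : sgraph T) :
  bool := ~~ has_induced H G.

Lemma forb_iso (U : finType) (K : sgraph U) (S T : finType)
  (G : sgraph S) (H : sgraph T) :
  isomorphic G H -> forb_prop K G -> forb_prop K H.
Proof.
move=> /existsP[f /and3P[/eqP cST /injectiveP fI /forallP fE]].
have [g fK gK] : bijective f by apply: inj_card_bij fI _; rewrite cST.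
apply: contra => /has_inducedP[h hI hE]; apply/has_inducedP.
exists (g \o h) => [|x y /=]; first exact: inj_comp (can_inj gK) hI.
by have /forallP/(_ (g (h y)))/eqP <- := fE (g (h x)); rewrite !gK.
Qed.

Lemma forb_del (U : finType) (K : sgraph U) (T : finType) (G : sgraph T)
  (v : T) : forb_prop K G -> forb_prop K (induced G [set~ v]).
Proof.
apply: contra => /has_inducedP[h hI hE]; apply/has_inducedP.
exists (fun x => val (h x)) => [x y /val_inj/hI//|x y].
by rewrite -hE adj_induced.
Qed.

Definition Forb (S : finType) (H : sgraph S) : hereditary :=
  Hereditary (@forb_iso S H) (@forb_del S H).

Lemma K2_subproof (t : nat) :
  [set [set inl i; inr j] | i : 'I_2, j : 'I_t]
    \subset [set e : {set 'I_2 + 'I_t} | #|e| == 2%N].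
Proof. by apply/subsetP => e /imset2P[i j _ _ ->]; rewrite inE cards2. Qed.

Definition K2 (t : nat) : sgraph ('I_2 + 'I_t)%type := SGraph (K2_subproof t).

Definition edit_dist (T : finType) (G G' : sgraph T) : nat :=
  #|(edges G :\: edges G') :|: (edges G' :\: edges G)|.

(* No distance exceeds 'C(#|T|, 2), so this default value only matters when the
   property contains no graph on T. *)
Definition edit_dist_to (P : hereditary) (T : finType) (G : sgraph T) : nat :=
  \big[minn/'C(#|T|, 2)]_(G' : sgraph T | P T G') edit_dist G G'.

From mathcomp Require Import all_classical all_reals all_analysis.
Import numFieldNormedType.Exports.

(* By isomorphism invariance, the n-vertex graphs may be taken on 'I_n. *)
Definition edit_ratio (R : realType) (P : hereditary) (p : R) (n : nat) : R :=
  (\max_(G : sgraph 'I_n |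
      (#|edges G|%:Z == Num.floor (p * 'C(n, 2)%:R))) edit_dist_to P G)%:R
  / 'C(n, 2)%:R.

(* limn is an unspecified value when the sequence diverges, so statements about
   ed should also assert cvgn (edit_ratio P p). *)
Definition ed (R : realType) (P : hereditary) (p : R) : R :=
  limn (edit_ratio P p).

(* Main.v *)
(* Upper bound: colour the vertices with t - 1 colours so that at most a fraction
   1 / (t - 1) of the non-edges is monochromatic, and add these. The colour classes
   become t - 1 cliques, so no t vertices are independent.

   Lower bound: take G quasirandom of density p, with vertices in F x F for a finite
   field F and (a, b) ~ (c, d) when b + d - a c lies in a fixed set S. Let G' have
   no induced K_{2,t}. A regularity argument yields clusters that are pairwise regular in
   G', on which the average edit density is no larger than on the whole graph, and
   inside each of them t pairwise regular subclusters. A pair of clusters is white,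
   black or gray when its G'-density is near 0, near 1 or in between; a cluster is
   black when two of its subclusters are dense to each other and white otherwise.
   White and black pairs force edit densities p and 1 - p, and an embedding lemma
   forbids K_{2,t} in this coloured graph. What remains is a weighted Turan problem,
   linear in p, whose critical case is p = 2 / (t + 1): the gray pairs do not outnumber
   the white ones plus t - 2 times the black ones, where every vertex also counts as
   a pair of its own colour. At a minimal weighting all vertices are black and no pair
   is; two vertices have at most t - 1 common closed gray neighbours, and counting
   over the closed gray neighbourhood of size D of the heaviest vertex gives
   (D - (t - 1)) (D - t) < 0, which is impossible for an integer D. *)

Require Import Defs.
From mathcomp Require Import all_boot all_order all_algebra.
From mathcomp Require Import all_classical all_reals all_analysis.
From mathcomp Require finfield.
From mathcomp Require Import fintype finset ring lra zify.
Import Order.TTheory GRing.Theory Num.Theory.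
Import numFieldNormedType.Exports.
Set Implicit Arguments.
Unset Strict Implicit.
Unset Printing Implicit Defensive.
Local Open Scope ring_scope.

(** * The weighted Turan problem for coloured regularity graphs *)

(* The hypotheses combine to [(D - tau) * (D - tau - 1) < 0], or, for large [D],
   to [D < tau]. *)
Lemma core_arith (x D N tau s u : int) :
  3 <= tau -> 0 < x -> x <= N -> s <= N -> s <= D * x ->
  N + tau * x < 2 * s ->
  D * (N + 1) + tau * s <= 2 * u -> u <= x * D + tau * (N - x) -> False.
Proof.
move=> t3 x0 xN sN sD Ns uge ule.
(* Eliminate [u] between the last two hypotheses, then [s] by [N + tau * x < 2 * s]. If the
   coefficient of [x] is nonnegative, [N < x * (2 * D - tau)] finishes the proof; if it is negative,
   [tau * x < N] does. *)
have key : x * (4 * tau - 4 * D + tau * tau) < (3 * tau - 2 * D) * N by nia.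
have [c|c] := lerP 0 (4 * tau - 4 * D + tau * tau).
  have [c2|c2] := lerP (3 * tau - 2 * D) 0; first by nia.
  have : N < x * (2 * D - tau) by nia.
  move=> h.
  have : x * (4 * tau - 4 * D + tau * tau) < x * ((3 * tau - 2 * D) * (2 * D - tau)).
    by apply: lt_trans key _; rewrite mulrCA ltr_pM2l.
  rewrite ltr_pM2l // => h2.
  have : (D - tau) * (D - tau - 1) < 0 by lia.
  have [h3|h3] : D - tau <= 0 \/ 1 <= D - tau by lia.
    by nia.
  by nia.
have h : tau * x < N by lia.
have h2 : tau * ((2 * D - 3 * tau) * N) < N * (4 * D - 4 * tau - tau * tau).
  apply: (@lt_trans _ _ (tau * x * (4 * D - 4 * tau - tau * tau))); nia.
have h3 : tau * (2 * D - 3 * tau) < 4 * D - 4 * tau - tau * tau.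
  by rewrite -(@ltr_pM2l _ N); [lia|lia].
nia.
Qed.

Section Crg.
(* A coloured regularity graph on [I]: a pair is black if [black] holds, otherwise
   gray if [gray] holds, otherwise white; [vb] is the set of black vertices. *)
Variables (I : finType) (t : nat) (gray black : rel I) (vb : pred I).

(* At [p = 2 / (t + 1)] white, black and gray pairs cost [p], [1 - p] and [0];
   multiplied by [t + 1] and shifted by the mean [1] this is the weight below. *)
Definition crg_weight (i j : I) : int :=
  if i == j then (if vb i then t%:Z - 2 else 1)
  else if black i j then t%:Z - 2 else if gray i j then -1 else 1.

Local Notation M := crg_weight.
Definition crg_row (x : I -> int) (i : I) : int := \sum_j M i j * x j.
Definition crg_form (x : I -> int) : int := \sum_i x i * crg_row x i.

Hypothesis t4 : (4 <= t)%N.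
Hypothesis gray_sym : symmetric gray.
Hypothesis black_sym : symmetric black.
(** Each of these three hypotheses excludes one placement of K_{2,t}: both sides inside white
    clusters; the [t]-side inside a white cluster and the two other vertices in black ones; all
    vertices in black clusters, the [t]-side spread over [S]. *)
Hypothesis white_white : forall i j, i != j -> ~~ vb i -> ~~ vb j -> ~~ gray i j.
Hypothesis white_black : forall w i j, ~~ vb w -> vb i -> vb j -> i != j ->
  gray w i -> gray w j -> black i j.
Hypothesis black_black : forall (i j : I) (S : {set I}), vb i -> vb j -> i != j ->
  ~~ black i j -> (t <= #|S|)%N ->
  {in S, forall k, [&& vb k, (k == i) || gray k i & (k == j) || gray k j]} ->
  exists k l, [/\ k \in S, l \in S, k != l & black k l].

Lemma crg_weight_sym i j : M i j = M j i.
Proof.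
by rewrite /crg_weight (eq_sym j) black_sym gray_sym; case: eqP => [->|].
Qed.

(* First-order optimality of [x] on its support forces all vertices of the support
   to be black and all pairs white or gray; summing the optimality conditions over
   the closed gray neighbourhood of the heaviest vertex then gives [core_arith]. *)
Lemma crg_core (x : I -> int) (i0 : I) :
  (forall i, 0 <= x i) -> 0 < x i0 ->
  (forall i, 0 < x i -> crg_row x i < 0) ->
  (forall i j, i != j -> 0 < x i -> 0 < x j -> 2 * M i j < M i i + M j j) ->
  False.
Proof.
move=> x0 xi0 row pair.
pose N := \sum_j x j.
have xz j : ~~ (0 < x j) -> x j = 0 by have := x0 j; lia.
have Nge i : x i <= N by rewrite /N (bigD1 i) //= lerDl sumr_ge0.
have nblack i j : i != j -> 0 < x i -> 0 < x j -> ~~ black i j.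
  move=> ij xi xj; have := pair i j ij xi xj; rewrite /crg_weight !eqxx (negPf ij).
  by case: (black i j) => //; case: (vb i); case: (vb j); lia.
have onewhite i j : i != j -> 0 < x i -> 0 < x j -> ~~ vb i -> vb j.
  move=> ij xi xj wi; apply/negPn/negP => wj.
  have := pair i j ij xi xj; rewrite /crg_weight !eqxx (negPf ij).
  by rewrite (negPf wi) (negPf wj) (negPf (nblack _ _ ij xi xj)) (negPf (white_white ij wi wj)).
(* The support has no black pairs, so off the diagonal the weight is 1 minus twice the gray
   indicator. *)
have rowE i : 0 < x i ->
    crg_row x i = N + (M i i + 1) * x i - 2 * \sum_(j | (j == i) || gray i j) x j.
  move=> xi; rewrite /crg_row /N (bigD1 i) //= [\sum_j x j](bigD1 i) //=.
  rewrite [X in _ - 2 * X](bigD1 i) ?eqxx //=.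
  rewrite [X in 2 * (_ + X)]big_mkcond [X in _ + X = _]big_mkcond.
  rewrite [\sum_(j | j != i) x j]big_mkcond /=.
  suff -> : \sum_j (if j != i then M i j * x j else 0) =
     \sum_j (if j != i then x j else 0)
       - 2 * \sum_j (if ((j == i) || gray i j) && (j != i) then x j else 0) by ring.
  rewrite mulr_sumr -sumrB; apply: eq_bigr => j _.
  case: (eqVneq j i) => [->|ji] /=; first by ring.
  rewrite andbT; have [xj|/xz ->] := boolP (0 < x j); last by case: ifP; lia.
  rewrite /crg_weight eq_sym (negPf ji) (negPf (nblack _ _ _ xi xj)) 1?eq_sym//.
  by case: ifP; lia.
(* A white [i] in the support has exactly one gray neighbour [u] there, as two would form a black
   pair. Then row [i] gives [N < 2 * x u], while row [u] gives [(t - 1) * x u < N]. *)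
have allb i : 0 < x i -> vb i.
  move=> xi; apply/negPn/negP => wi.
  have := row i xi; rewrite rowE // [M i i]/crg_weight eqxx (negPf wi) => h.
  have [u /andP[gu ui] xu] : exists2 u, gray i u && (u != i) & 0 < x u.
    case: (pickP [pred u | [&& gray i u, u != i & 0 < x u]]) => [u /and3P[??]|no].
      by exists u => //; apply/andP.
    move: h; rewrite (bigD1 i) ?eqxx //= big1 ?addr0; first by have := x0 i; have := Nge i; lia.
    move=> j /andP[/orP[/eqP->|gj] ji]; first by rewrite eqxx in ji.
    by apply: xz; have := no j; rewrite /= gj ji /= => ->.
  have vbu := onewhite i u _ xi xu wi; rewrite eq_sym in vbu; have {}vbu := vbu ui.
  have h2 : N + 2 * x i - 2 * (x i + x u) < 0.
    move: h; rewrite (bigD1 i) ?eqxx //= (bigD1 u) /= ?gu ?orbT ?ui //=.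
    rewrite [X in _ + (_ + X)]big1 ?addr0 => [|j]; first by lia.
    case/andP => /andP[/orP[/eqP->|gj] ji] ju; first by rewrite eqxx in ji.
    apply: xz; apply/negP => xj.
    have vbj : vb j by apply: (onewhite i j) => //; rewrite eq_sym.
    have := nblack u j _ xu xj; rewrite eq_sym ju => /(_ isT)/negP; apply.
    by apply: (white_black wi vbu vbj _ gu gj); rewrite eq_sym.
  have := row u xu; rewrite rowE // [M u u]/crg_weight eqxx vbu.
  suff : \sum_(j | (j == u) || gray u j) x j <= N by nia.
  by rewrite [N](bigID (fun j => (j == u) || gray u j)) /= lerDl sumr_ge0.
pose nb i := [set j | (0 < x j) && ((j == i) || gray i j)].
pose s i := \sum_(j in nb i) x j.
have sE i : \sum_(j | (j == i) || gray i j) x j = s i.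
  rewrite /s big_mkcond [RHS]big_mkcond; apply: eq_bigr => j _.
  rewrite inE; case: (boolP (0 < x j)) => //= /xz ->; by case: ifP.
have nbS i j : (i \in nb j) && (0 < x j) = (j \in nb i) && (0 < x i).
  by rewrite !inE gray_sym eq_sym -!andbA; do 2!bool_congr; rewrite andbC.
have row' i : 0 < x i -> N + (t%:Z - 1) * x i < 2 * s i.
  move=> xi; have := row i xi; rewrite rowE // sE [M i i]/crg_weight eqxx allb //.
  by lia.
have common i j : i != j -> 0 < x i -> 0 < x j -> (#|nb i :&: nb j| <= t.-1)%N.
  move=> ij xi xj; rewrite leqNgt; apply/negP => lt.
  have [||k [l [kS lS kl bkl]]] :=
      black_black (allb _ xi) (allb _ xj) ij (nblack _ _ ij xi xj) (S := nb i :&: nb j).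
  - by lia.
  - move=> k; rewrite !inE => /andP[/andP[xk ki] /andP[_ kj]].
    by rewrite allb //= !(gray_sym k) ki kj.
  move: kS lS; rewrite !inE => /andP[/andP[xk _] _] /andP[/andP[xl _] _].
  by rewrite (negPf (nblack _ _ kl xk xl)) in bkl.
pose i := [arg max_(i > i0) x i]%O.
have xmax j : x j <= x i by rewrite /i; case: arg_maxP => // k _; apply.
have xi : 0 < x i by apply: lt_le_trans xi0 (xmax _).
(* Here [tau] is [t - 1]; the strict inequalities [row'] between integers account for the [N + 1] in
   the bound on [u]. *)
apply: (@core_arith (x i) #|nb i|%:Z N (t%:Z - 1) (s i) (\sum_(j in nb i) s j)).
- lia.
- exact: xi.
- exact: Nge.
- rewrite /s [N](bigID [in nb i]) /= lerDl sumr_ge0 //.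
- have -> : #|nb i|%:Z * x i = \sum_(j in nb i) x i by rewrite sumr_const -mulr_natl natz.
  exact: ler_sum.
- exact: row'.
- have : \sum_(j in nb i) (N + 1 + (t%:Z - 1) * x j) <= \sum_(j in nb i) 2 * s j.
    apply: ler_sum => j; rewrite inE => /andP[xj _].
    by have := row' j xj; lia.
  rewrite big_split /= -!mulr_sumr sumr_const -/(s i) => h.
  by apply: le_trans h; rewrite -mulr_natl natz; lia.
(* Double counting: [i] itself contributes [x i] times the size of [nb i], and any other vertex of
   the support shares at most [t - 1] closed gray neighbours with [i]. *)
- have -> : \sum_(j in nb i) s j = \sum_m x m * #|nb i :&: nb m|%:Z.
    rewrite /s.
    have -> : \sum_(j in nb i) \sum_(m in nb j) x m =
              \sum_m \sum_(j in nb i) (if m \in nb j then x m else 0).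
      by rewrite exchange_big /=; apply: eq_bigr => j _; rewrite big_mkcond.
    apply: eq_bigr => m _; rewrite -big_mkcondr /=.
    have [xm|/xz ->] := boolP (0 < x m); last by rewrite big1 // mul0r.
    rewrite (eq_bigl [in nb i :&: nb m]) => [|j]; first by rewrite sumr_const -mulr_natr natz.
    rewrite /= in_setI; case: (boolP (j \in nb i)) => //= ji.
    have := nbS m j; rewrite xm andbT.
    by move: ji; rewrite inE => /andP[-> _]; rewrite andbT.
  rewrite (bigD1 i) //= setIid.
  have -> : N - x i = \sum_(m | m != i) x m by rewrite /N (bigD1 i) //= addrAC subrr add0r.
  rewrite lerD2l mulr_sumr; apply: ler_sum => m mi.
  have [xm|/xz ->] := boolP (0 < x m); last by rewrite mul0r mulr0.
  rewrite mulrC ler_wpM2r ?x0 //.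
  by have := common i m _ xi xm; rewrite eq_sym => /(_ mi); lia.
Qed.

Lemma crg_form_add (x d : I -> int) (s : int) :
  crg_form (fun k => x k + s * d k) =
  crg_form x + 2 * s * (\sum_k d k * crg_row x k) + s * s * crg_form d.
Proof.
have rowD i : crg_row (fun k => x k + s * d k) i = crg_row x i + s * crg_row d i.
  rewrite /crg_row mulr_sumr -big_split /=; apply: eq_bigr => j _; ring.
have sym : \sum_k d k * crg_row x k = \sum_k x k * crg_row d k.
  rewrite /crg_row; under eq_bigr do rewrite mulr_sumr.
  rewrite exchange_big /=; apply: eq_bigr => k _; rewrite mulr_sumr.
  by apply: eq_bigr => j _; rewrite crg_weight_sym; ring.
have -> : 2 * s * (\sum_k d k * crg_row x k) =
   s * (\sum_k d k * crg_row x k) + s * (\sum_k x k * crg_row d k).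
  by rewrite -sym; ring.
rewrite /crg_form !mulr_sumr -!big_split /=; apply: eq_bigr => i _.
by rewrite rowD; ring.
Qed.

Lemma sum_delta (f : I -> int) i j :
  \sum_k ((k == i)%:Z - (k == j)%:Z) * f k = f i - f j.
Proof.
under eq_bigr do rewrite mulrBl.
rewrite sumrB (bigD1 i) //= eqxx mul1r big1 ?addr0 => [|k /negPf->]; last by rewrite mul0r.
rewrite (bigD1 j) //= eqxx mul1r big1 ?addr0 // => k /negPf->; by rewrite mul0r.
Qed.

(** This is the effect of moving weight [s] from [j] to [i] at constant total; the coefficient of
    [s * s] is the curvature along that move. *)
Lemma crg_form_shift (x : I -> int) (s : int) i j :
  crg_form (fun k => x k + s * ((k == i)%:Z - (k == j)%:Z)) =
  crg_form x + 2 * s * (crg_row x i - crg_row x j)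
    + s * s * (M i i + M j j - 2 * M i j).
Proof.
rewrite crg_form_add sum_delta /crg_form sum_delta.
have r k : crg_row (fun k => (k == i)%:Z - (k == j)%:Z) k = M k i - M k j.
  by rewrite -(sum_delta (M k)) /crg_row; apply: eq_bigr => l _; rewrite mulrC.
by rewrite !r (crg_weight_sym j i); ring.
Qed.

Lemma crg_weight_bound i j : -1 <= M i j <= t%:Z - 2.
Proof. by rewrite /crg_weight; do ![case: ifP => _]; lia. Qed.

(* Otherwise blow every vertex up by [L] and take integer weights of total [N] and
   form at most [- L ^ 2], first of minimal support and then of minimal form:
   integrality leaves enough room for strict inequalities in [crg_core]. *)
Lemma crg_nonneg : 0 <= \sum_i \sum_j M i j.
Proof.
rewrite leNgt; apply/negP => neg.
(* Some row on the support will be at most [- L / q], that is [- (t + 1)], and rows on the support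
   differ by at most [t]; so all of them will be negative. *)
pose q := #|I|; pose L := (q * t.+1)%N; pose N := (q * L)%N.
pose X := {ffun I -> 'I_N.+1}.
pose v (x : X) i := (x i : nat)%:Z.
pose Q x := crg_form (v x).
pose P (x : X) := \sum_i v x i == N%:Z.
pose supp (x : X) := [set i | (0 < x i)%N].
have q0 : (0 < q)%N.
  rewrite lt0n; apply/negP => /eqP/card0_eq I0; move: neg.
  by rewrite big_pred0 // ltxx.
have LN : (L < N.+1)%N by rewrite ltnS /N leq_pmull.
pose x1 : X := [ffun=> Ordinal LN].
have Px1 : P x1.
  by rewrite /P /v; under eq_bigr do rewrite ffunE; rewrite sumr_const -mulr_natl natz /N -/q PoszM.
have Qx1 : Q x1 <= - (L%:Z * L%:Z).
  have -> : Q x1 = L%:Z * L%:Z * (\sum_i \sum_j M i j).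
    rewrite /Q /crg_form /crg_row mulr_sumr; apply: eq_bigr => i _.
    by rewrite !mulr_sumr; apply: eq_bigr => j _; rewrite /v !ffunE /=; ring.
  by nia.
pose Pa x := P x && (Q x <= - (L%:Z * L%:Z)).
have Pax1 : Pa x1 by rewrite /Pa Px1 Qx1.
case: (arg_minnP (fun x => #|supp x|) Pax1) => xa /andP[Pxa Qxa] mina.
pose Pb x := P x && (supp x \subset supp xa).
have Pbxa : Pb xa by rewrite /Pb Pxa subxx.
case: (arg_minP Q Pbxa) => x /andP[Px sx] minb.
have Qx : Q x <= - (L%:Z * L%:Z) by apply: le_trans (minb _ Pbxa) Qxa.
have sxE : supp x = supp xa.
  by apply/eqP; rewrite eqEcard sx mina // /Pa Px.
have N_sum : \sum_i v x i = N%:Z by exact/eqP.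
have shift (s : int) i j : i != j -> - v x i <= s -> s <= v x j ->
    0 < v x i -> 0 < v x j ->
  exists y : X, [/\ Q y = crg_form (fun k => v x k + s * ((k == i)%:Z - (k == j)%:Z)),
     P y, supp y \subset supp x &
     (s = - v x i -> i \notin supp y) /\ (s = v x j -> j \notin supp y)].
  move=> ij si sj xi xj.
  pose w k : int := v x k + s * ((k == i)%:Z - (k == j)%:Z).
  have ji : (j == i) = false by rewrite eq_sym (negPf ij).
  have xij : v x i + v x j <= N%:Z.
    rewrite -N_sum (bigD1 i) //= (bigD1 j) ?ji //= addrA lerDl.
    by apply: sumr_ge0.
  have wb k : 0 <= w k <= N%:Z.
    rewrite /w; have [->|ki] := eqVneq k i; first by rewrite (negPf ij); lia.
    have [->|kj] := eqVneq k j; first by lia.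
    by rewrite subrr mulr0 addr0 lez_nat -ltnS /=; exact: ltn_ord (x k).
  (* By [wb] the new weights are in range, so [inord] does not take its default value. *)
  pose y : X := [ffun k => inord `|w k|%N].
  have vy : v y =1 w.
    move=> k; rewrite /v /y ffunE inordK; last by have := wb k; lia.
    by have := wb k; lia.
  exists y; split.
  - rewrite /Q /crg_form /crg_row; apply: eq_bigr => k _; rewrite vy; congr (_ * _).
    by apply: eq_bigr => l _; rewrite vy.
  - rewrite /P; under eq_bigr do rewrite vy; rewrite big_split /= N_sum -mulr_sumr.
    have := sum_delta (fun=> 1) i j; under eq_bigr do rewrite mulr1.
    by move=> ->; rewrite subrr mulr0 addr0.
  - apply/subsetP => k; rewrite !inE => yk.
    have : 0 < w k by rewrite -vy /v; lia.
    rewrite /w; have [->|ki] := eqVneq k i; first by move: xi; rewrite /v; lia.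
    have [->|kj] := eqVneq k j; first by move: xj; rewrite /v; lia.
    by rewrite subrr mulr0 addr0 /v ltz_nat.
  - split=> se; rewrite inE -leqNgt.
      by have := vy i; rewrite /v /w eqxx (negPf ij) se /v; lia.
    by have := vy j; rewrite /v /w eqxx ji se /v; lia.
have nonneg i : 0 <= v x i by [].
have L0 : (0 < L)%N by rewrite muln_gt0 q0.
have [i0 xi0] : exists i, 0 < v x i.
  have [i xi|no] := pickP (fun i => 0 < v x i); first by exists i.
  move: Qx; rewrite /Q /crg_form big1 => [|i _]; first by nia.
  have -> : v x i = 0 by have := no i; have := nonneg i; lia.
  by rewrite mul0r.
apply: (@crg_core (v x) i0) => //.
(* Moving one unit from [j] to [i] cannot lower the minimal form, and the curvature is at most
   [2 * (t - 1)]. *)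
- have le1 i j : 0 < v x i -> 0 < v x j -> crg_row (v x) j <= crg_row (v x) i + t%:Z.
    have [->|ij] := eqVneq i j; first by lia.
    move=> xi xj; have [||y [Qy Py sy _]] := shift 1 i j ij _ _ xi xj; [lia|lia|].
    have := minb y; rewrite /Pb Py -sxE => /(_ sy).
    rewrite Qy crg_form_shift -/(Q x).
    have := crg_weight_bound i i; have := crg_weight_bound j j.
    have := crg_weight_bound i j; lia.
  (* The rows weighted by [x] sum to [Q x], so some row of the support is at most [Q x / N]. *)
  have [i xi ri] : exists2 i, 0 < v x i & N%:Z * crg_row (v x) i <= - (L%:Z * L%:Z).
    have [i /andP[xi ri]|no] :=
      pickP (fun i => (0 < v x i) && (N%:Z * crg_row (v x) i <= - (L%:Z * L%:Z))).
      by exists i.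
    have : N%:Z * (1 - L%:Z * L%:Z) <= N%:Z * Q x.
      rewrite -{1}N_sum mulr_suml /Q /crg_form mulr_sumr; apply: ler_sum => i _.
      rewrite mulrCA; have [xi|xi] := boolP (0 < v x i).
        by apply: ler_wpM2l => //; have := no i; rewrite xi /=; lia.
      have -> : v x i = 0 by have := nonneg i; lia.
      by rewrite !mul0r.
    have : 0 < N%:Z by rewrite /N; lia.
    nia.
  move=> j xj; have := le1 i j xi xj.
  have : q%:Z * crg_row (v x) i <= - L%:Z.
    move: ri; rewrite /N; nia.
  rewrite /L; nia.
- move=> i j ij xi xj; rewrite ltNge; apply/negP => conc.
  (* With nonpositive curvature, weight can be moved in the direction of nonpositive slope until [i]
     or [j] is empty. The form does not rise and the support shrinks, against the choice of [xa]. *)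
  have [s [s1 s2 s3 s4]] : exists s : int, [/\ - v x i <= s, s <= v x j,
      s = - v x i \/ s = v x j & s * (crg_row (v x) i - crg_row (v x) j) <= 0].
    have [c|c] := lerP 0 (crg_row (v x) i - crg_row (v x) j).
      by exists (- v x i); split=> //; [lia|left|nia].
    by exists (v x j); split=> //; [lia|right|nia].
  have [y [Qy Py sy [nyi nyj]]] := shift s i j ij s1 s2 xi xj.
  have Pay : Pa y.
    rewrite /Pa Py Qy crg_form_shift /=; apply: le_trans Qx; rewrite -/(Q x).
    rewrite -addrA gerDl -[X in _ <= X]addr0 lerD //.
      by rewrite -mulrA pmulr_rle0.
    by rewrite mulr_ge0_le0 ?subr_le0 // -expr2 sqr_ge0.
  have := mina y Pay; rewrite leqNgt => /negP; apply; rewrite -sxE.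
  apply: proper_card; rewrite properE sy /=; apply/negP => /subsetP sub.
  case: s3 => s3.
    by have /negP := nyi s3; apply; apply: sub; rewrite inE.
  by have /negP := nyj s3; apply; apply: sub; rewrite inE.
Qed.
End Crg.

(** * Densities and greedy embedding *)

Section Density.
Variables (R : realFieldType) (T : finType).
Implicit Types (e f : T -> T -> bool) (A B X Y : {set T}).

Definition pairs (f : T -> T -> R) A B : R := \sum_(x in A) \sum_(y in B) f x y.

Definition avg (f : T -> T -> R) A B : R := pairs f A B / (#|A|%:R * #|B|%:R).

Definition large (eps : R) A X := (X \subset A) && (eps * #|A|%:R <= #|X|%:R).

(** The lower half of regularity, for an arbitrary relation so that it applies to adjacency and to
    non-adjacency alike. *)
Definition rich (eps delta : R) e A B :=
  forall X Y, large eps A X -> large eps B Y ->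
    delta * (#|X|%:R * #|Y|%:R) <= pairs (fun x y => (e x y)%:R) X Y.

(* Greedy embedding: vertices are chosen one at a time, each outside the few
   vertices having atypically few compatible neighbours in a later candidate
   set, so that every candidate set shrinks by a factor delta / 2 only. *)
Lemma rich_embedding (I : eqType) (h : I -> I -> T -> T -> bool)
  (B : I -> {set T}) (eps delta : R) (s : seq I) (rho : R) (C : I -> {set T})
  (t0 : T) :
  0 < eps -> 0 < delta <= 1 -> uniq s ->
  {in s, forall i, (0 < #|B i|)%N} ->
  {in s &, forall i j, i != j -> rich eps delta (h i j) (B i) (B j)} ->
  {in s &, forall i j x y, h i j x y = h j i y x} ->
  (size s).+1%:R * eps <= rho * (delta / 2) ^+ (size s) ->
  {in s, forall i, large rho (B i) (C i)} ->
  exists x : I -> T, {in s, forall i, x i \in C i} /\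
    {in s &, forall i j, i != j -> h i j (x i) (x j)}.
Proof.
move=> e0 /andP[d0 d1].
elim: s rho C => [|i s IH] rho C; first by exists (fun=> t0).
move=> /= /andP[iNs us] B0 rB hs eps_rho CB.
set n := size s in eps_rho IH *.
have iS : i \in i :: s by rewrite inE eqxx.
have sS j : j \in s -> j \in i :: s by rewrite inE orbC => ->.
have d2 : 0 < delta / 2 <= 1 by lra.
have rho0 : 0 < rho.
  have : 0 < rho * (delta / 2) ^+ n.+1.
    by apply: lt_le_trans eps_rho; rewrite mulr_gt0 ?ltr0n.
  by rewrite pmulr_lgt0 // exprn_gt0 //; case/andP: d2.
have n_rho : n.+2%:R * eps <= rho.
  apply: le_trans eps_rho _; apply: ler_piMr; first exact: ltW.
  by case/andP: d2 => d20 d21; apply: exprn_ile1 => //; apply: ltW.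
have e_rho : eps <= rho.
  apply: le_trans n_rho; by apply: ler_peMl; rewrite ?ler1n // ltW.
have C0 j : j \in i :: s -> (0 : R) < #|C j|%:R.
  move=> jS; have /andP[_ Cj] := CB j jS; apply: lt_le_trans Cj.
  by rewrite mulr_gt0 ?ltr0n ?B0.
pose nbr x j := [set y in C j | h i j x y].
pose bad j := [set x in C i | #|nbr x j|%:R < delta / 2 * #|C j|%:R].
(* Otherwise the bad set is large and, paired with [C j], contradicts richness. *)
have badS j : j \in s -> #|bad j|%:R < eps * #|B i|%:R.
  move=> js; have jS := sS j js; rewrite ltNge; apply/negP => lb.
  have ij : i != j by apply: contraNneq iNs => ->.
  have /andP[CiB _] := CB i iS; have /andP[CjB Cj] := CB j jS.
  have b0 : (0 : R) < #|bad j|%:R.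
    by apply: lt_le_trans lb; rewrite mulr_gt0 // ltr0n B0.
  have lb2 : large eps (B i) (bad j).
    rewrite /large lb andbT; apply: subset_trans CiB.
    by apply/subsetP => x; rewrite inE => /andP[].
  have lC : large eps (B j) (C j).
    rewrite /large CjB /=; apply: le_trans Cj.
    by rewrite ler_wpM2r ?ler0n.
  have := rB i j iS jS ij _ _ lb2 lC.
  apply/negP; rewrite -ltNge /pairs.
  have : \sum_(x in bad j) \sum_(y in C j) (h i j x y)%:R <=
      \sum_(x in bad j) delta / 2 * #|C j|%:R :> R.
    apply: ler_sum => x; rewrite inE => /andP[_ /ltW]; apply: le_trans.
    rewrite -natr_sum ler_nat -sum1_card -big_mkcondr /=.
    rewrite [leqRHS](eq_bigl (fun y => (y \in C j) && h i j x y)) // => y.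
    by rewrite inE.
  move/le_lt_trans; apply; rewrite sumr_const -mulr_natr.
  have := mulr_gt0 d0 (mulr_gt0 b0 (C0 j jS)); lra.
(* Union bound: together the bad sets have fewer than [rho * #|B i|] elements. *)
have [x0 x0C x0N] : exists2 x, x \in C i & {in s, forall j, x \notin bad j}.
  have [x /andP[xC /allP xN]|no] := pickP [pred x | (x \in C i) && all (fun j => x \notin bad j) s].
    by exists x.
  exfalso.
  have : #|C i|%:R <= \sum_(j <- s) #|bad j|%:R :> R.
    rewrite -natr_sum ler_nat -sum1_card.
    have -> : (\sum_(j <- s) #|bad j| = \sum_(j <- s) \sum_(x in C i) (x \in bad j))%N.
      apply: eq_bigr => j _; rewrite -sum1_card -big_mkcondr /=; apply: eq_bigl => x.
      by rewrite !inE andbA andbb.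
    rewrite exchange_big /=; apply: leq_sum => x xC.
    have := no x; rewrite /= xC /= => /negbT/allPn[j js /negPn xb].
    by rewrite (big_rem j) //= xb leq_addr.
  apply/negP; rewrite -ltNge.
  have : \sum_(j <- s) #|bad j|%:R <= \sum_(j <- s) eps * #|B i|%:R :> R.
    by rewrite big_seq [leRHS]big_seq; apply: ler_sum => j /badS/ltW.
  move/le_lt_trans; apply.
  rewrite big_const_seq count_predT iter_addr_0 -/n -[_ *+ n]mulr_natl.
  have /andP[_ h1] := CB i iS; apply: lt_le_trans h1.
  rewrite mulrA ltr_pM2r ?ltr0n ?B0 //; apply: lt_le_trans n_rho.
  by rewrite ltr_pM2r // ltr_nat.
have [] := IH (rho * (delta / 2)) (nbr x0) us.
- by move=> j /sS; apply: B0.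
- by move=> j k /sS jS /sS kS; apply: rB.
- by move=> j k /sS jS /sS kS; apply: hs.
- rewrite -mulrA -exprS; apply: le_trans eps_rho.
  by rewrite ler_pM2r // ler_nat.
- move=> j js; have /andP[CjB Cj] := CB j (sS j js); apply/andP; split.
    by apply: subset_trans CjB; apply/subsetP => y; rewrite inE => /andP[].
  have := x0N j js; rewrite inE x0C /= -leNgt; apply: le_trans.
  by rewrite mulrAC mulrC ler_wpM2l //; case/andP: d2 => /ltW.
move=> x [xC xh]; exists (fun k => if k == i then x0 else x k).
have ni j : j \in s -> (j == i) = false by move=> js; apply/negP => /eqP ji; rewrite -ji js in iNs.
have x0h j : j \in s -> h i j x0 (x j) by move=> /xC; rewrite inE => /andP[].
split.
  move=> j; rewrite inE => /predU1P[->|js]; first by rewrite eqxx.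
  by rewrite ni //; have := xC j js; rewrite inE => /andP[].
move=> j k; rewrite !inE => /predU1P[->|js] /predU1P[->|ks]; rewrite ?eqxx // ?ni // => jk.
- exact: x0h.
- by have -> := hs j i (sS j js) iS (x j) x0; exact: x0h.
- exact: xh.
Qed.
End Density.

(** * Regularity by minimisation *)

Section Avg.
Variables (R : realType) (T : finType).
Implicit Types (f : T -> T -> R) (A B X Y Z : {set T}).

Definition piece A X (b : bool) : {set T} := if b then X else A :\: X.

Definition frac A X : R := #|X|%:R / #|A|%:R.

Lemma frac_ge0 A X : 0 <= frac A X.
Proof. by rewrite divr_ge0. Qed.

Lemma sum_piece (g : T -> R) A X : X \subset A ->
  \sum_(b : bool) \sum_(x in piece A X b) g x = \sum_(x in A) g x.
Proof.
move=> XA; rewrite big_bool /= [RHS](bigID [in X]) /=; congr (_ + _).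
  by apply: eq_bigl => x; rewrite andb_idl // => /(subsetP XA).
by apply: eq_bigl => x; rewrite inE andbC.
Qed.

Lemma sum_frac A X : X \subset A -> (0 < #|A|)%N -> \sum_(b : bool) frac A (piece A X b) = 1.
Proof.
move=> XA A0; rewrite /frac -mulr_suml.
have := sum_piece (fun=> 1) XA; rewrite sumr_const -[1 *+ _]/(#|A|%:R) => <-.
under [X in X^-1]eq_bigr do rewrite sumr_const.
rewrite mulfV //; have := sum_piece (fun=> 1) XA.
under eq_bigr do rewrite sumr_const.
by move=> ->; rewrite sumr_const pnatr_eq0 -lt0n.
Qed.

(** The weight cancels the size of [X]. For empty [X] both sides vanish, so the splitting identities
    below also allow empty pieces, on which [avg] takes the default value 0. *)
Lemma frac_avgl f A X Z : (0 < #|A|)%N -> frac A X * avg f X Z = pairs f X Z / (#|A|%:R * #|Z|%:R).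
Proof.
move=> A0; have [X0|X0] := posnP #|X|.
  by rewrite /frac /pairs X0 mul0r mul0r big1 ?mul0r // => x; rewrite (card0_eq X0).
rewrite /frac /avg; have := X0; have := A0; rewrite -!(ltr0n R) => a0 x0.
have [Z0|Z0] := posnP #|Z|; first by rewrite Z0 !mulr0 invr0 !mulr0.
move: Z0; rewrite -(ltr0n R) => z0.
by field; rewrite !lt0r_neq0.
Qed.

Lemma pairsC f A B : pairs f A B = pairs (fun x y => f y x) B A.
Proof. exact: exchange_big. Qed.

Lemma avgC f A B : avg f A B = avg (fun x y => f y x) B A.
Proof. by rewrite /avg pairsC mulrC [in LHS]mulrC [#|A|%:R * _]mulrC. Qed.

Lemma avg_splitl f A X Z : X \subset A -> (0 < #|A|)%N ->
  \sum_(b : bool) frac A (piece A X b) * avg f (piece A X b) Z = avg f A Z.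
Proof.
move=> XA A0; under eq_bigr do rewrite frac_avgl //.
by rewrite -mulr_suml /pairs sum_piece.
Qed.

Lemma avg_splitr f A X Z : X \subset A -> (0 < #|A|)%N ->
  \sum_(b : bool) frac A (piece A X b) * avg f Z (piece A X b) = avg f Z A.
Proof.
by move=> XA A0; rewrite avgC -(avg_splitl _ _ XA A0); apply: eq_bigr => b _; rewrite avgC.
Qed.

Lemma pairs_ge0 f A B : (forall x y, 0 <= f x y) -> 0 <= pairs f A B.
Proof. by move=> f0; do 2!apply: sumr_ge0 => ? _. Qed.

Lemma pairs_le f A B (c : R) : (forall x y, x \in A -> y \in B -> f x y <= c) ->
  pairs f A B <= c * (#|A|%:R * #|B|%:R).
Proof.
move=> fc; apply: (@le_trans _ _ (\sum_(x in A) \sum_(y in B) c)).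
  by apply: ler_sum => x xA; apply: ler_sum => y yB; exact: fc.
by rewrite !sumr_const -mulrnA -[leLHS]mulr_natr natrM [_%:R * _]mulrC.
Qed.

Lemma avg_01 f A B : (forall x y, 0 <= f x y <= 1) -> 0 <= avg f A B <= 1.
Proof.
move=> f01; apply/andP; split.
  by rewrite divr_ge0 ?mulr_ge0 ?pairs_ge0 // => x y; case/andP: (f01 x y).
have [A0|A0] := posnP #|A|; first by rewrite /avg A0 mul0r invr0 mulr0.
have [B0|B0] := posnP #|B|; first by rewrite /avg B0 mulr0 invr0 mulr0.
rewrite ler_pdivrMr ?mulr_gt0 ?ltr0n //; apply: pairs_le => x y _ _.
by case/andP: (f01 x y).
Qed.

(* From [ln x <= x - 1] at [x = (frac A X)^-1]. *)
Lemma frac_ln A X : X \subset A -> (0 < #|A|)%N ->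
  frac A X * ln (#|A|%:R) - (1 - frac A X) <= frac A X * ln (#|X|%:R).
Proof.
move=> XA A0; have [X0|X0] := posnP #|X|.
  by rewrite /frac X0 mul0r !mul0r subr0 sub0r oppr_le0.
have x0 : (0 : R) < #|X|%:R by rewrite ltr0n.
have a0 : (0 : R) < #|A|%:R by rewrite ltr0n.
have f0 : 0 < frac A X by rewrite divr_gt0.
have fE : (frac A X)^-1 = #|A|%:R / #|X|%:R by rewrite invf_div.
have := @le_ln1Dx R ((frac A X)^-1 - 1).
rewrite [1 + (_ - 1)]addrC subrK fE ln_div ?posrE // -fE => /(_ _) h.
have {}h : ln #|A|%:R - ln #|X|%:R <= (frac A X)^-1 - 1.
  by apply: h; rewrite ltrBrDl subrr invr_gt0.
have := ler_wpM2l (ltW f0) h.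
by rewrite !mulrBr mulfV ?gt_eqF // mulr1; lra.
Qed.

(** The errors [1 - frac] of the two pieces in [frac_ln] add up to 1. *)
Lemma sum_frac_ln A X : X \subset A -> (0 < #|A|)%N ->
  ln (#|A|%:R) - 1 <= \sum_(b : bool) frac A (piece A X b) * ln (#|piece A X b|%:R) :> R.
Proof.
move=> XA A0; have := sum_frac XA A0; rewrite !big_bool /=.
have := frac_ln XA A0; have : A :\: X \subset A by exact: subsetDl.
move=> /(frac_ln) /(_ A0).
move: (ln _) (ln _) (ln _) (frac _ _) (frac _ _) => l1 l2 l3 u v h1 h2 uv.
have : (u + v) * l3 = l3 by rewrite uv mul1r.
lra.
Qed.


Lemma avg_split2 f A B X Y : X \subset A -> Y \subset B ->
  (0 < #|A|)%N -> (0 < #|B|)%N ->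
  \sum_(b : bool) \sum_(c : bool) frac A (piece A X b) * frac B (piece B Y c) *
     avg f (piece A X b) (piece B Y c) = avg f A B.
Proof.
move=> XA YB A0 B0; rewrite -(avg_splitl f B XA A0); apply: eq_bigr => b _.
by rewrite -(avg_splitr f _ YB B0) mulr_sumr; apply: eq_bigr => c _; rewrite mulrA.
Qed.

End Avg.

(** The excess over [m ^+ 2] is the variance of [d]; only its term at [c0] is kept. *)
Lemma weighted_sqr_ge (R : realFieldType) (C : finType) (w d : C -> R) (m : R) (c0 : C) :
  (forall c, 0 <= w c) -> \sum_c w c = 1 -> \sum_c w c * d c = m ->
  m ^+ 2 + w c0 * (d c0 - m) ^+ 2 <= \sum_c w c * d c ^+ 2.
Proof.
move=> w0 w1 wd.
have -> : \sum_c w c * d c ^+ 2 = m ^+ 2 + \sum_c w c * (d c - m) ^+ 2.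
  have -> : \sum_c w c * (d c - m) ^+ 2 =
      \sum_c (w c * d c ^+ 2 + (- (2 * m)) * (w c * d c) + m ^+ 2 * w c).
    by apply: eq_bigr => c _; ring.
  by rewrite !big_split /= -!mulr_sumr w1 wd; ring.
rewrite lerD2l (bigD1 c0) //= lerDl; apply: sumr_ge0 => c _.
by rewrite mulr_ge0 ?sqr_ge0.
Qed.

Section Regularity.
Variables (R : realType) (I T : finType) (e : rel T) (D : T -> T -> R).
Implicit Types (A V : {ffun I -> {set T}}).

Definition edens (A B : {set T}) : R := avg (fun x y => (e x y)%:R) A B.

Lemma edens01 (A B : {set T}) : 0 <= edens A B <= 1.
Proof. by apply: avg_01 => x y; case: (e x y); rewrite ?lexx ?ler01. Qed.

(* The logarithms penalise small sets: splitting a set costs at most [tau] on average. *)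
Definition potential (eta tau : R) A : R :=
  \sum_i \sum_(j | j != i) (avg D (A i) (A j) - eta * edens (A i) (A j) ^+ 2)
  - tau * \sum_i ln (#|A i|%:R).

Section Split.
Variables (A : {ffun I -> {set T}}) (i0 j0 : I) (X Y : {set T}).
Hypotheses (A_gt0 : forall i, (0 < #|A i|)%N) (ij0 : i0 != j0).
Hypotheses (XA : X \subset A i0) (YA : Y \subset A j0).

(** With probabilities [cell_weight], the four cells form a random refinement that preserves every
    pair average in mean, see [sum_cell_avg]. *)
Definition cell (c : bool * bool) : {ffun I -> {set T}} :=
  [ffun k => if k == i0 then piece (A i0) X c.1
             else if k == j0 then piece (A j0) Y c.2 else A k].

Definition cell_weight (c : bool * bool) : R :=
  frac R (A i0) (piece (A i0) X c.1) * frac R (A j0) (piece (A j0) Y c.2).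

Lemma cell_weight_ge0 c : 0 <= cell_weight c.
Proof. by rewrite mulr_ge0 ?frac_ge0. Qed.

Lemma sum_cell_l (g : bool -> R) :
  \sum_c cell_weight c * g c.1 = \sum_(b : bool) frac R (A i0) (piece (A i0) X b) * g b.
Proof.
rewrite -(pair_bigA _ (fun b c => cell_weight (b, c) * g b)) /=.
apply: eq_bigr => b _; rewrite -mulr_suml; congr (_ * _).
by rewrite /cell_weight /= -mulr_sumr sum_frac // mulr1.
Qed.

Lemma sum_cell_r (g : bool -> R) :
  \sum_c cell_weight c * g c.2 = \sum_(b : bool) frac R (A j0) (piece (A j0) Y b) * g b.
Proof.
rewrite -(pair_bigA _ (fun b c => cell_weight (b, c) * g c)) /= exchange_big /=.
apply: eq_bigr => b _; rewrite -mulr_suml; congr (_ * _).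
by rewrite /cell_weight /= -mulr_suml sum_frac // mul1r.
Qed.

Lemma sum_cell1 : \sum_c cell_weight c = 1.
Proof.
have := sum_cell_l (fun=> 1); under eq_bigr do rewrite mulr1.
by move=> ->; under eq_bigr do rewrite mulr1; rewrite sum_frac.
Qed.

Lemma sum_cell_avg (f : T -> T -> R) i j : i != j ->
  \sum_c cell_weight c * avg f (cell c i) (cell c j) = avg f (A i) (A j).
Proof.
move=> ij; have ji : (j == i) = false by rewrite eq_sym (negPf ij).
have const (g : R) : \sum_c cell_weight c * g = g.
  by rewrite -mulr_suml sum_cell1 mul1r.
have [ii|ni] := eqVneq i i0.
  subst i; have [jj|nj] := eqVneq j j0.
    subst j; rewrite -(avg_split2 f XA YA) //.
    rewrite (pair_bigA _ (fun b c =>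
     frac R (A i0) (piece (A i0) X b) * frac R (A j0) (piece (A j0) Y c) *
     avg f (piece (A i0) X b) (piece (A j0) Y c))) /=.
    by apply: eq_bigr => -[b c] _; rewrite !ffunE !eqxx ji.
  rewrite -(avg_splitl f (A j) XA) // -sum_cell_l; apply: eq_bigr => c _.
  by rewrite !ffunE eqxx ji (negPf nj).
have [ii|ni'] := eqVneq i j0.
  subst i; have [jj|nj] := eqVneq j i0.
    subst j; rewrite avgC -(avg_split2 _ XA YA) //.
    rewrite (pair_bigA _ (fun b c =>
     frac R (A i0) (piece (A i0) X b) * frac R (A j0) (piece (A j0) Y c) *
     avg (fun x y => f y x) (piece (A i0) X b) (piece (A j0) Y c))) /=.
    by apply: eq_bigr => -[b c] _; rewrite !ffunE !eqxx (negPf ni) avgC.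
  rewrite -(avg_splitl f (A j) YA) // -sum_cell_r; apply: eq_bigr => c _.
  by rewrite !ffunE eqxx ji (negPf nj) (negPf ni).
have [jj|nj] := eqVneq j i0.
  subst j; rewrite -(avg_splitr f (A i) XA) // -sum_cell_l; apply: eq_bigr => c _.
  by rewrite !ffunE eqxx (negPf ni) (negPf ni').
have [jj|nj'] := eqVneq j j0.
  subst j; rewrite -(avg_splitr f (A i) YA) // -sum_cell_r; apply: eq_bigr => c _.
  by rewrite !ffunE eqxx (negPf ni) (negPf ni') (negPf nj).
rewrite -[RHS]const; apply: eq_bigr => c _.
by rewrite !ffunE (negPf ni) (negPf ni') (negPf nj) (negPf nj').
Qed.

Lemma sum_cell_ln i :
  ln (#|A i|%:R) - ((i == i0)%:R + (i == j0)%:R) <= \sum_c cell_weight c * ln (#|cell c i|%:R).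
Proof.
have [ii|ni] := eqVneq i i0.
  subst i; rewrite (negPf ij0) addr0; apply: le_trans (sum_frac_ln R XA (A_gt0 _)) _.
  rewrite -sum_cell_l; apply: ler_sum => c _.
  by rewrite ffunE eqxx.
have [ii|ni'] := eqVneq i j0.
  subst i; rewrite add0r; apply: le_trans (sum_frac_ln R YA (A_gt0 _)) _.
  rewrite -sum_cell_r; apply: ler_sum => c _.
  by rewrite ffunE eqxx (negPf ni).
under eq_bigr do rewrite ffunE (negPf ni) (negPf ni').
by rewrite -mulr_suml sum_cell1 mul1r addr0 subr0.
Qed.

(** The averages of [D] are preserved, the logarithms at [i0] and [j0] cost at most [tau] each, and
    convexity makes the squared densities grow. Of this growth only the contribution of the ordered
    pair [(i0, j0)] at the cell [X], [Y] is kept. *)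
Lemma sum_cell_potential (eta tau : R) : 0 <= eta -> 0 <= tau ->
  \sum_c cell_weight c * potential eta tau (cell c) <=
  potential eta tau A + 2 * tau
   - eta * (frac R (A i0) X * frac R (A j0) Y * (edens X Y - edens (A i0) (A j0)) ^+ 2).
Proof.
move=> eta0 tau0.
set gain := frac R _ X * _ * _.
have gain0 : 0 <= gain
  by apply: mulr_ge0 (sqr_ge0 _); apply: mulr_ge0 (frac_ge0 _ _ _) (frac_ge0 _ _ _).
have -> : \sum_c cell_weight c * potential eta tau (cell c) =
  \sum_i \sum_(j | j != i) (\sum_c cell_weight c * avg D (cell c i) (cell c j)
     - eta * \sum_c cell_weight c * edens (cell c i) (cell c j) ^+ 2)
  - tau * \sum_i \sum_c cell_weight c * ln (#|cell c i|%:R).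
  under eq_bigr do rewrite mulrBr.
  rewrite sumrB; congr (_ - _).
    under eq_bigr do rewrite mulr_sumr.
    rewrite exchange_big /=; apply: eq_bigr => i _.
    under eq_bigr do rewrite mulr_sumr.
    rewrite exchange_big /=; apply: eq_bigr => j _.
    rewrite mulr_sumr -sumrB; apply: eq_bigr => c _; ring.
  rewrite exchange_big /= mulr_sumr; apply: eq_bigr => c _.
  by rewrite -mulr_sumr; ring.
have lnle : \sum_i ln (#|A i|%:R) - 2 <= \sum_i \sum_c cell_weight c * ln (#|cell c i|%:R) :> R.
  have -> : (2 : R) = \sum_i ((i == i0)%:R + (i == j0)%:R).
    rewrite big_split /= (bigD1 i0) //= eqxx big1 => [|i /negPf -> //].
    by rewrite (bigD1 j0) //= eqxx big1 => [|i /negPf -> //]; rewrite !addr0.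
  by rewrite -sumrB; apply: ler_sum => i _; exact: sum_cell_ln.
have pairle i j : j != i ->
   \sum_c cell_weight c * avg D (cell c i) (cell c j)
     - eta * \sum_c cell_weight c * edens (cell c i) (cell c j) ^+ 2 <=
   avg D (A i) (A j) - eta * edens (A i) (A j) ^+ 2
     - eta * (((i == i0) && (j == j0))%:R * gain).
  rewrite eq_sym => ij; rewrite sum_cell_avg // -addrA -opprD -mulrDr lerD2l lerN2 ler_wpM2l //.
  apply: le_trans (weighted_sqr_ge (true, true) cell_weight_ge0 sum_cell1 (sum_cell_avg _ ij)).
  rewrite lerD2l; case: (eqVneq i i0) => [->|]; last first.
    by rewrite mul0r mulr_ge0 ?cell_weight_ge0 ?sqr_ge0.
  case: (eqVneq j j0) => [->|]; last first.
    by rewrite mul0r mulr_ge0 ?cell_weight_ge0 ?sqr_ge0.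
  by rewrite mul1r !ffunE !eqxx eq_sym (negPf ij0).
rewrite /potential.
have sumle : \sum_i \sum_(j | j != i) (\sum_c cell_weight c * avg D (cell c i) (cell c j)
     - eta * \sum_c cell_weight c * edens (cell c i) (cell c j) ^+ 2) <=
   \sum_i \sum_(j | j != i) (avg D (A i) (A j) - eta * edens (A i) (A j) ^+ 2) - eta * gain.
  have -> : eta * gain = \sum_i \sum_(j | j != i) eta * (((i == i0) && (j == j0))%:R * gain).
    rewrite (bigD1 i0) //= (bigD1 j0) 1?eq_sym //= !eqxx mul1r.
    rewrite big1 => [|j /andP[_ /negPf ->]]; last by rewrite mul0r mulr0.
    rewrite big1 ?addr0 // => i /negPf ->; rewrite big1 // => j _; by rewrite mul0r mulr0.
  rewrite -sumrB; apply: ler_sum => i _; rewrite -sumrB; apply: ler_sum => j.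
  exact: pairle.
have := ler_wpM2l tau0 lnle.
by move: sumle; move: (\sum_i \sum_(j | _) _) (\sum_i \sum_(j | _) _) => S1 S2; lra.
Qed.

End Split.
End Regularity.

Section RegularityLemma.
Variables (R : realType) (I : finType) (eps eta : R).
Hypotheses (eps0 : 0 < eps) (eta0 : 0 < eta).

Definition regular (T : finType) (e : rel T) (A B : {set T}) :=
  forall X Y, large eps A X -> large eps B Y -> `|edens R e X Y - edens R e A B| <= eps.

(* A minimiser of [potential] is regular: splitting it along an irregular pair
   would decrease the weighted average of the potential over the four cells. *)
Lemma regularity : exists2 delta : R, 0 < delta &
  forall (T : finType) (e : rel T) (D : T -> T -> R) (V : I -> {set T}),
  (forall x y, 0 <= D x y <= 1) -> (forall i, (0 < #|V i|)%N) ->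
  exists A : I -> {set T}, [/\ forall i, large delta (V i) (A i),
    forall i j, i != j -> regular e (A i) (A j) &
    \sum_i \sum_(j | j != i) avg D (A i) (A j) <=
      \sum_i \sum_(j | j != i) avg D (V i) (V j) + eta].
Proof.
pose q2 : R := (#|I| * #|I|)%:R.
pose eta' := eta / (q2 + 1).
have q20 : 0 <= q2 by rewrite ler0n.
have eta'0 : 0 < eta' by rewrite divr_gt0 // ltr_wpDl.
have eta'q : eta' * q2 <= eta.
  by rewrite /eta' mulrAC ler_pdivrMr ?ltr_wpDl // ler_wpM2l ?lerDl // ltW.
(* Splitting an irregular pair gains at least [eta' * eps ^+ 4], which equals [4 * tau] and beats
   the cost [2 * tau] of the logarithms. *)
pose tau := eta' * (eps * eps * eps ^+ 2) / 4.
have tau0 : 0 < tau by rewrite divr_gt0 // mulr_gt0 // mulr_gt0 ?exprn_gt0 // mulr_gt0.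
(* [K] bounds the possible gain of a minimiser over [V] in the other terms of the potential, hence
   [tau] times its loss in each logarithm. *)
pose K := q2 + eta.
exists (expR (- (K / tau))); first exact: expR_gt0.
move=> T e D V D01 V0.
pose P (A : {ffun I -> {set T}}) := [forall i, (0 < #|A i|)%N && (A i \subset V i)].
pose Vf : {ffun I -> {set T}} := [ffun i => V i].
have PV : P Vf by apply/forallP => i; rewrite ffunE V0 /=.
case: (arg_minP (potential e D eta' tau) PV) => A /forallP PA minA.
have A0 i : (0 < #|A i|)%N by have /andP[] := PA i.
have AV i : A i \subset V i by have /andP[] := PA i.
have sum_le (F : I -> I -> R) : (forall i j, 0 <= F i j <= 1) ->
    0 <= \sum_i \sum_(j | j != i) F i j <= q2.
  move=> F01; apply/andP; split.
    by apply: sumr_ge0 => i _; apply: sumr_ge0 => j _; have /andP[] := F01 i j.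
  have -> : q2 = \sum_(i : I) \sum_(j : I) 1.
    by rewrite !sumr_const -mulrnA.
  apply: ler_sum => i _; rewrite big_mkcond; apply: ler_sum => j _.
  by case: ifP => _ //; have /andP[] := F01 i j.
have main := minA Vf PV.
have sumE (B : {ffun I -> {set T}}) : potential e D eta' tau B =
    \sum_i \sum_(j | j != i) avg D (B i) (B j)
    - eta' * (\sum_i \sum_(j | j != i) edens R e (B i) (B j) ^+ 2)
    - tau * \sum_i ln (#|B i|%:R).
  rewrite /potential; congr (_ - _); rewrite mulr_sumr -sumrB; apply: eq_bigr => i _.
  by rewrite mulr_sumr -sumrB.
have sq01 (B : {ffun I -> {set T}}) i j : 0 <= edens R e (B i) (B j) ^+ 2 <= 1.
  have /andP[d0 d1] := edens01 R e (B i) (B j).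
  by rewrite sqr_ge0 expr_le1.
move: main; rewrite !sumE.
have VfE i : Vf i = V i by rewrite ffunE.
have /andP[sA0 sA1] := sum_le (fun i j => edens R e (A i) (A j) ^+ 2) (sq01 A).
have /andP[sV0 sV1] := sum_le (fun i j => edens R e (Vf i) (Vf j) ^+ 2) (sq01 Vf).
have /andP[aA0 aA1] :=
  sum_le (fun i j => avg D (A i) (A j)) (fun i j => avg_01 (A i) (A j) D01).
have /andP[aV0 aV1] :=
  sum_le (fun i j => avg D (Vf i) (Vf j)) (fun i j => avg_01 (Vf i) (Vf j) D01).
have -> : \sum_i \sum_(j | j != i) avg D (V i) (V j) =
          \sum_i \sum_(j | j != i) avg D (Vf i) (Vf j).
  by apply: eq_bigr => i _; apply: eq_bigr => j _; rewrite !VfE.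
have lnAV i : ln (#|A i|%:R) <= ln (#|Vf i|%:R) :> R.
  by rewrite VfE ler_ln ?posrE ?ltr0n // ler_nat subset_leq_card.
have lnsum : \sum_i ln (#|A i|%:R) <= \sum_i ln (#|Vf i|%:R) :> R.
  by apply: ler_sum => i _.
set a := \sum_i \sum_(j | _) avg D (A i) (A j) in aA0 aA1 *.
set v := \sum_i \sum_(j | _) avg D (Vf i) (Vf j) in aV0 aV1 *.
set a2 := \sum_i \sum_(j | _) edens R e (A i) _ ^+ 2 in sA0 sA1 *.
set v2 := \sum_i \sum_(j | _) edens R e (Vf i) _ ^+ 2 in sV0 sV1 *.
move=> main.
have ea : eta' * a2 <= eta' * q2 by rewrite ler_wpM2l // ltW.
have ev : 0 <= eta' * v2 by rewrite mulr_ge0 // ltW.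
have et : tau * \sum_i ln (#|A i|%:R) <= tau * \sum_i ln (#|Vf i|%:R) by rewrite ler_wpM2l // ltW.
exists A; split.
- move=> i; rewrite /large AV /=.
  have : tau * (ln (#|Vf i|%:R) - ln (#|A i|%:R)) <= K.
    apply: (@le_trans _ _ (tau * (\sum_i (ln (#|Vf i|%:R) - ln (#|A i|%:R))))).
      apply: ler_wpM2l; first exact: ltW.
      rewrite (bigD1 i) //= lerDl; apply: sumr_ge0 => k _.
      by rewrite subr_ge0.
    by rewrite sumrB mulrBr /K; lra.
  rewrite mulrC -ler_pdivlMr // VfE => h.
  have vi : (0 : R) < #|V i|%:R by rewrite ltr0n.
  have ai : (0 : R) < #|A i|%:R by rewrite ltr0n.
  rewrite -ler_ln ?posrE ?mulr_gt0 ?expR_gt0 // lnM ?posrE ?expR_gt0 // expRK.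
  by lra.
- move=> i0 j0 ij X Y /andP[XA Xl] /andP[YA Yl]; rewrite leNgt; apply/negP => irr.
  have := sum_cell_potential e D A0 ij XA YA (ltW eta'0) (ltW tau0).
  apply/negP; rewrite -ltNge.
  have fX : eps <= frac R (A i0) X by rewrite /frac ler_pdivlMr ?ltr0n.
  have fY : eps <= frac R (A j0) Y by rewrite /frac ler_pdivlMr ?ltr0n.
  have sq : eps ^+ 2 <= (edens R e X Y - edens R e (A i0) (A j0)) ^+ 2.
    rewrite -[leRHS]real_normK ?num_real //; rewrite lerXn2r ?nnegrE ?ltW //.
    exact: lt_trans irr.
  have g : eps * eps * eps ^+ 2 <= frac R (A i0) X * frac R (A j0) Y *
             (edens R e X Y - edens R e (A i0) (A j0)) ^+ 2.
    apply: ler_pM; [by rewrite mulr_ge0 // ltW | exact: sqr_ge0 | | exact: sq].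
    by apply: ler_pM => //; exact: ltW.
  have {}g := ler_wpM2l (ltW eta'0) g.
  apply: (@lt_le_trans _ _ (potential e D eta' tau A)).
    have t4 : tau * 4 = eta' * (eps * eps * eps ^+ 2) by rewrite /tau divfK.
    lra.
  rewrite -[leLHS]mul1r -(sum_cell1 R A0 XA YA) mulr_suml; apply: ler_sum => c _.
  (* A cell of nonzero weight has nonempty pieces, so it competes with the minimiser [A]. *)
  have [w0|w0] := eqVneq (cell_weight R A i0 j0 X Y c) 0; first by rewrite w0 !mul0r.
  rewrite ler_wpM2l ?cell_weight_ge0 //; apply: minA; apply/forallP => k.
  move: w0; rewrite /cell_weight /frac !mulf_eq0 !negb_or => /andP[/andP[w1 _] /andP[w2 _]].
  rewrite !pnatr_eq0 -!lt0n in w1 w2.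
  rewrite ffunE; case: eqP => [->|_].
    rewrite w1 /=; apply: subset_trans (AV i0); case: c.1 => //=; exact: subsetDl.
  case: eqP => [->|_]; last by rewrite A0 AV.
  rewrite w2 /=; apply: subset_trans (AV j0); case: c.2 => //=; exact: subsetDl.
- rewrite -/a; lra.
Qed.

End RegularityLemma.

(** * A quasirandom graph over a finite field *)

Section Mixing.
Variables (R : realFieldType) (F : finFieldType) (S : {set F}).
Let P : R := #|F|%:R.

(** For fixed [x] and [u], [inc x y = u] is a line of slope [x.1] in [y]; this is point-line
    incidence in a form symmetric in [x] and [y]. *)
Definition inc (x y : F * F) : F := x.2 + y.2 - x.1 * y.1.

Lemma incC x y : inc x y = inc y x.
Proof. by rewrite /inc mulrC [x.2 + _]addrC. Qed.

Definition deviation (u : F) : R := (u \in S)%:R - #|S|%:R / P.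

Lemma P_gt0 : 0 < P.
Proof. by rewrite ltr0n; apply/card_gt0P; exists 0. Qed.

Lemma sum_deviation : \sum_u deviation u = 0.
Proof.
rewrite sumrB sumr_const -[_ *+ _]mulr_natr divfK ?gt_eqF ?P_gt0 //.
by rewrite -natr_sum -big_mkcond sum1_card subrr.
Qed.

Lemma deviation_sqr_le u v : deviation u * deviation v <= 1.
Proof.
have rho : 0 <= #|S|%:R / P <= 1.
  rewrite divr_ge0 // ler_pdivrMr ?P_gt0 // mul1r ler_nat.
  exact: max_card.
have dev w : -1 <= deviation w <= 1.
  rewrite /deviation; move: rho; move: (_ / P) => rho /andP[r0 r1].
  by case: (w \in S) => /=; apply/andP; split; lra.
have /andP[u1 u2] := dev u; have /andP[v1 v2] := dev v.
have : 0 <= (1 - deviation u) * (1 + deviation v) by apply: mulr_ge0; lra.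
have : 0 <= (1 + deviation u) * (1 - deviation v) by apply: mulr_ge0; lra.
lra.
Qed.

(* For rows with distinct first coordinates, [(inc x y, inc x' y)] is uniform
   over [F * F] as [y] varies: the two rows are exactly uncorrelated. *)
Lemma deviation_orthogonal (x x' : F * F) : x.1 != x'.1 ->
  \sum_y deviation (inc x y) * deviation (inc x' y) = 0.
Proof.
move=> xx'; have d0 : x'.1 - x.1 != 0 by rewrite subr_eq0 eq_sym.
pose f (y : F * F) := (inc x y, inc x' y).
(* The inverse of [f], from solving two linear equations of different slopes for [y]. *)
pose g (w : F * F) : F * F :=
  let c := (w.1 - w.2 - x.2 + x'.2) / (x'.1 - x.1) in (c, w.1 - x.2 + x.1 * c).
have fK : cancel g f.
  by case=> a b; rewrite /f /g /inc /=; congr (_, _); field.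
have gK : cancel f g.
  case=> a b; rewrite /f /g /inc /=.
  have -> : (x.2 + b - x.1 * a - (x'.2 + b - x'.1 * a) - x.2 + x'.2) / (x'.1 - x.1) = a by field.
  by congr (_, _); ring.
rewrite (reindex g) /=; last by exists f => ? _; [exact: fK|exact: gK].
transitivity (\sum_(w : F * F) deviation w.1 * deviation w.2).
  apply: eq_bigr => w _; have := fK w; rewrite /f.
  by move: (g w) => y <-.
rewrite -(pair_bigA _ (fun a b => deviation a * deviation b)) /=.
under eq_bigr do rewrite -mulr_sumr sum_deviation mulr0.
by rewrite big1.
Qed.

(** Cauchy-Schwarz over [B], then expansion of the square. Rows with different first coordinates are
    orthogonal, and each [x] has at most [P] partners with the same first coordinate, each
    contributing at most [P ^+ 2]. *)
Lemma mixing (T : finType) (g : T -> F * F) (A B : {set T}) : injective g ->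
  (pairs (fun x y => deviation (inc (g x) (g y))) A B) ^+ 2 <= P ^+ 7.
Proof.
move=> gI.
have cardB (C : {set T}) : #|C|%:R <= P ^+ 2 :> R.
  rewrite -natrX ler_nat; apply: leq_trans (max_card _) _.
  by rewrite -(card_codom gI) -mulnn -card_prod max_card.
pose r (y : F * F) := \sum_(x in A) deviation (inc (g x) y).
have -> : pairs (fun x y => deviation (inc (g x) (g y))) A B = \sum_(y in B) r (g y).
  exact: exchange_big.
have CS : (\sum_(y in B) r (g y)) ^+ 2 <= #|B|%:R * \sum_(y in B) r (g y) ^+ 2.
  have : 0 <= \sum_(y in B) \sum_(z in B) (r (g y) - r (g z)) ^+ 2.
    by apply: sumr_ge0 => y _; apply: sumr_ge0 => z _; exact: sqr_ge0.
  have -> : \sum_(y in B) \sum_(z in B) (r (g y) - r (g z)) ^+ 2 =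
     2 * (#|B|%:R * \sum_(y in B) r (g y) ^+ 2) - 2 * (\sum_(y in B) r (g y)) ^+ 2.
    have -> : 2 * (#|B|%:R * \sum_(y in B) r (g y) ^+ 2) =
      \sum_(y in B) \sum_(z in B) (r (g y) ^+ 2 + r (g z) ^+ 2).
      under [RHS]eq_bigr do rewrite big_split /= sumr_const.
      rewrite big_split /= sumr_const sumrMnl -[_ *+ #|B|]mulr_natl; ring.
    rewrite [(\sum_(y in B) r (g y)) ^+ 2]expr2 mulr_suml mulr_sumr -sumrB.
    apply: eq_bigr => y _; rewrite mulr_sumr mulr_sumr -sumrB; apply: eq_bigr => z _; ring.
  lra.
have rB : \sum_(y in B) r (g y) ^+ 2 <= \sum_y r y ^+ 2.
  rewrite -(big_imset (fun y => r y ^+ 2)) /=; last by move=> ? ? _ _ /gI.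
  by rewrite [leRHS](bigID [in g @: B]) /= lerDl sumr_ge0 // => y _; exact: sqr_ge0.
have rsum : \sum_y r y ^+ 2 <= P ^+ 5.
  have -> : \sum_y r y ^+ 2 = \sum_(x in A) \sum_(x' in A)
      \sum_y deviation (inc (g x) y) * deviation (inc (g x') y).
    under eq_bigr do rewrite expr2 mulr_suml.
    rewrite exchange_big /=; apply: eq_bigr => x _.
    under eq_bigr do rewrite mulr_sumr.
    by rewrite exchange_big.
  have -> : P ^+ 5 = P ^+ 2 * (P * P ^+ 2) by rewrite -exprS -exprD.
  apply: (@le_trans _ _ (\sum_(x in A) P * P ^+ 2)); last first.
    rewrite sumr_const -[leLHS]mulr_natl ler_wpM2r ?cardB //.
    by rewrite mulr_ge0 ?exprn_ge0 // ltW ?P_gt0.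
  apply: ler_sum => x _.
  rewrite (bigID (fun x' => (g x').1 == (g x).1)) /= [X in _ + X]big1 ?addr0; last first.
    by move=> x' /andP[_ ne]; apply: deviation_orthogonal; rewrite eq_sym.
  apply: (@le_trans _ _ (\sum_(x' in A | (g x').1 == (g x).1) P ^+ 2)).
    apply: ler_sum => x' _.
    apply: (@le_trans _ _ (\sum_(y : F * F) 1)).
      by apply: ler_sum => y _; exact: deviation_sqr_le.
    by rewrite sumr_const card_prod mulnn natrX.
  rewrite sumr_const -[leLHS]mulr_natl ler_wpM2r ?exprn_ge0 ?(ltW P_gt0) //.
  rewrite /P ler_nat.
  rewrite -(card_in_imset (f := fun x' => (g x').2)) ?max_card // => x1 x2.
  move=> /andP[_ /eqP e1] /andP[_ /eqP e2] e3; apply: gI.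
  by rewrite [g x1]surjective_pairing [g x2]surjective_pairing e1 e2 e3.
apply: le_trans CS _; rewrite (_ : P ^+ 7 = P ^+ 2 * P ^+ 5); last by rewrite -exprD.
apply: ler_pM; [exact: ler0n | | exact: cardB | exact: le_trans rB rsum].
by apply: sumr_ge0 => y _; exact: sqr_ge0.
Qed.
End Mixing.

(** * Edit distance and edge counts *)

Section GraphBasics.
Variable T : finType.
Implicit Types (G : sgraph T) (E : {set {set T}}).

Lemma adjxx G x : adj G x x = false.
Proof.
apply/negP => /(subsetP (edgesP G)); by rewrite inE setUid cards1.
Qed.

Lemma adjC G x y : adj G x y = adj G y x.
Proof. by rewrite /adj setUC. Qed.

Lemma graph_of_subproof (r : rel T) :
  [set e : {set T} | (#|e| == 2%N) && [exists x, exists y, (e == [set x; y]) && r x y]]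
    \subset [set e : {set T} | #|e| == 2%N].
Proof. by apply/subsetP => e; rewrite !inE => /andP[]. Qed.

Definition graph_of (r : rel T) : sgraph T := SGraph (graph_of_subproof r).

Lemma adj_graph_of (r : rel T) x y : symmetric r -> adj (graph_of r) x y = (x != y) && r x y.
Proof.
move=> rs; rewrite /adj inE cards2 eqSS eqb1; case: (eqVneq x y) => //= xy.
apply/existsP/idP => [[a /existsP[b /andP[/eqP ab rab]]]|rxy]; last first.
  by exists x; apply/existsP; exists y; rewrite eqxx.
have : x \in [set a; b] by rewrite -ab !inE eqxx.
have : y \in [set a; b] by rewrite -ab !inE eqxx orbT.
rewrite !inE => /orP[]/eqP ya /orP[]/eqP xa; subst=> //; rewrite ?eqxx // in xy.
by rewrite rs.
Qed.

Lemma sum_pairs_edges E : E \subset [set e : {set T} | #|e| == 2%N] ->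
  (\sum_x \sum_y ([set x; y] \in E) = #|E|.*2)%N.
Proof.
move=> E2.
have -> : (\sum_x \sum_y ([set x; y] \in E) =
  \sum_(e in E) \sum_x \sum_y ([set x; y] == e))%N.
  rewrite [RHS]exchange_big /=; apply: eq_bigr => x _; rewrite [RHS]exchange_big /=.
  apply: eq_bigr => y _; have [xyE|xyE] := boolP ([set x; y] \in E).
    by rewrite (bigD1 _ xyE) /= eqxx big1 // => e /andP[_ /negPf]; rewrite eq_sym => ->.
  by rewrite big1 // => e eE; case: eqP => // exy; rewrite exy eE in xyE.
transitivity (\sum_(e in E) 2)%N; last by rewrite sum_nat_const muln2.
apply: eq_bigr => e eE.
have := subsetP E2 e eE; rewrite inE => /eqP e2.
have xyE x y : ([set x; y] == e) = [&& x \in e, y \in e & y != x].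
  apply/eqP/and3P => [xye|[xe ye yx]].
    rewrite -xye !inE !eqxx orbT; split=> //; apply/negP => /eqP yx.
    by move: e2; rewrite -xye yx setUid cards1.
  apply/eqP; rewrite eqEcard e2 cards2 eq_sym yx /= andbT.
  by apply/subsetP => z; rewrite !inE => /orP[]/eqP->.
transitivity (\sum_(x in e) 1)%N; last by rewrite sum1_card.
rewrite [RHS]big_mkcond; apply: eq_bigr => x _.
have [xe|xe] := boolP (x \in e); last first.
  by rewrite big1 // => y _; rewrite xyE (negPf xe).
transitivity (\sum_(y in e :\ x) 1)%N.
  rewrite [RHS]big_mkcond; apply: eq_bigr => y _; rewrite xyE xe !inE /= andbC.
  by case: ifP.
by rewrite sum1_card; move: e2; rewrite (cardsD1 x) xe => -[].
Qed.

Definition edit_set G G' := (edges G :\: edges G') :|: (edges G' :\: edges G).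

Lemma edit_setE G G' x y : ([set x; y] \in edit_set G G') = adj G x y (+) adj G' x y.
Proof. by rewrite /edit_set !inE /adj; case: (_ \in edges G); case: (_ \in edges G'). Qed.

Lemma edit_set_sub G G' : edit_set G G' \subset [set e : {set T} | #|e| == 2%N].
Proof.
by apply/subsetP => e; rewrite !inE => /orP[]/andP[_ /(subsetP (edgesP _))]; rewrite inE.
Qed.

Lemma sum_edit G G' : (\sum_x \sum_y (adj G x y (+) adj G' x y) = (edit_dist G G').*2)%N.
Proof.
rewrite /edit_dist -/(edit_set G G') -(sum_pairs_edges (edit_set_sub G G')).
by apply: eq_bigr => x _; apply: eq_bigr => y _; rewrite edit_setE.
Qed.

Lemma sum_adj G : (\sum_x \sum_y adj G x y = #|edges G|.*2)%N.
Proof. exact: sum_pairs_edges (edgesP G). Qed.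

Lemma card_interpolate (S : finType) (A B : {set S}) k : A \subset B ->
  (#|A| <= k <= #|B|)%N -> exists C : {set S}, [/\ A \subset C, C \subset B & #|C| = k].
Proof.
move=> AB /andP[Ak kB]; rewrite -(subnKC Ak) in kB *.
elim: (k - #|A|)%N kB => [|m IH] kB; first by exists A; rewrite addn0.
have [|C [AC CB Cm]] := IH; first by apply: leq_trans kB; rewrite leq_add2l.
have : C \proper B by rewrite properEcard CB Cm -addnS.
case/properP => _ [x xB xC]; exists (x |: C); split.
- by apply: subset_trans AC _; exact: subsetUr.
- by rewrite subUset sub1set xB.
- by rewrite cardsU1 xC Cm addnS.
Qed.

Lemma card_pairs_set : #|[set e : {set T} | #|e| == 2%N]| = 'C(#|T|, 2).
Proof. exact: card_draws.
Qed.

(** Edges are only added or only deleted; one of the two truncated differences is 0, so their sum is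
    an absolute difference. *)
Lemma adjust_edges G k : (k <= 'C(#|T|, 2))%N ->
  exists G', #|edges G'| = k /\
    edit_dist G' G = ((k - #|edges G|) + (#|edges G| - k))%N.
Proof.
move=> kC; have [kG|Gk] := leqP k #|edges G|.
  have [|C [_ CG Ck]] := @card_interpolate _ set0 (edges G) k (sub0set _).
    by rewrite cards0.
  exists (SGraph (subset_trans CG (edgesP G))); split=> //=.
  rewrite /edit_dist /=; have -> : C :\: edges G = set0 by apply/eqP; rewrite setD_eq0.
  by rewrite set0U cardsD (setIidPr CG) Ck; move: kG; rewrite -subn_eq0 => /eqP->.
have [|C [GC C2 Ck]] := card_interpolate (k := k) (edgesP G).
  by rewrite (ltnW Gk) card_pairs_set.
exists (SGraph C2); split=> //=.
rewrite /edit_dist /=; have -> : edges G :\: C = set0 by apply/eqP; rewrite setD_eq0.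
rewrite setU0 cardsD (setIidPr GC) Ck; move: (ltnW Gk).
by rewrite -subn_eq0 => /eqP->; rewrite addn0.
Qed.

End GraphBasics.

(** * Quasirandom graphs with a prescribed number of edges *)

Section Quasirandom.
Variable R : realType.

(** Fields of order [2 ^ j] suffice, since their squared orders are the powers of 4. *)
Lemma galois_field_between (n : nat) : (1 < n)%N ->
  exists F : finFieldType, (n <= #|F| ^ 2 <= 4 * n)%N.
Proof.
move=> n1; have ex : exists j, (n <= 4 ^ j)%N by exists n; apply/ltnW/ltn_expl.
case: (ex_minnP ex) => j nj minj.
have j0 : (0 < j)%N by rewrite lt0n; apply/eqP => j0; rewrite j0 expn0 leqNgt n1 in nj.
have [F _ cF] := finfield.PrimePowerField (isT : prime 2) j0.
exists F; rewrite cF -expnM mulnC expnM; apply/andP; split; first exact: nj.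
rewrite -(prednK j0) expnS leq_mul2l /= ltnW // ltnNge; apply/negP => /minj.
by rewrite -ltnS prednK // ltnn.
Qed.

Lemma pairs_natr (T : finType) (r : T -> T -> bool) (A B : {set T}) :
  pairs (fun x y => (r x y)%:R) A B = (\sum_(x in A) \sum_(y in B) r x y)%N%:R :> R.
Proof. by rewrite natr_sum; apply: eq_bigr => x _; rewrite natr_sum. Qed.

Lemma pairs_setT_adj (T : finType) (G : sgraph T) :
  pairs (fun x y => (adj G x y)%:R) setT setT = 2 * #|edges G|%:R :> R.
Proof.
rewrite pairs_natr -natrM mul2n -sum_adj; congr (_%:R).
apply: eq_big => [x|x _]; first by rewrite inE.
by apply: eq_bigl => y; rewrite inE.
Qed.

Lemma pairs_adj_edit (T : finType) (G G' : sgraph T) (A B : {set T}) :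
  `|pairs (fun x y => (adj G x y)%:R) A B - pairs (fun x y => (adj G' x y)%:R) A B|
    <= 2 * (edit_dist G G')%:R :> R.
Proof.
rewrite /pairs -sumrB; apply: le_trans (ler_norm_sum _ _ _) _.
apply: (@le_trans _ _ (\sum_x \sum_y (adj G x y (+) adj G' x y)%:R)).
  rewrite big_mkcond; apply: ler_sum => x _; case: ifP => _; last exact: sumr_ge0.
  rewrite -sumrB; apply: le_trans (ler_norm_sum _ _ _) _.
  rewrite big_mkcond; apply: ler_sum => y _; case: ifP => _; last exact: ler0n.
  by case: (adj G x y); case: (adj G' x y); rewrite /= ?subrr ?subr0 ?sub0r ?normrN ?normr0 ?normr1.
rewrite -natrM mul2n -sum_edit natr_sum; apply: ler_sum => x _.
by rewrite natr_sum.
Qed.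

(** Three errors of size [kappa * n ^+ 2] arise: the mixing error, the removal of loops, and the
    rounding of [p] to a multiple of [1 / #|F|]. *)
Lemma quasirandom_approx (p kappa : R) : 0 <= p <= 1 -> 0 < kappa ->
  exists N : nat, forall n, (N <= n)%N ->
  exists G : sgraph 'I_n, forall A B : {set 'I_n},
    `|pairs (fun x y => (adj G x y)%:R) A B - p * (#|A|%:R * #|B|%:R)| <= 3 * kappa * n%:R ^+ 2.
Proof.
(* The number 256 is [4 ^ 4], from raising [P ^+ 2 <= 4 * n] to the fourth power in the mixing
   error; [kappa^-1] serves the loops and the rounding. *)
move=> /andP[p0 p1] k0; pose M := 256 / kappa ^+ 2 + kappa^-1 + 2.
have k20 : 0 < kappa ^+ 2 by rewrite exprn_gt0.
have a0 : 0 <= 256 / kappa ^+ 2 by apply: divr_ge0; [exact: ler0n|exact: ltW].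
have b0 : 0 <= kappa^-1 by rewrite invr_ge0 ltW.
have [M1 M2 M3] : [/\ 256 / kappa ^+ 2 <= M, kappa^-1 <= M & 2 <= M].
  by rewrite /M; move: (256 / _) (kappa^-1) a0 b0 => a b a0 b0; split; lra.
exists (Num.truncn (M ^+ 2)).+1 => n Nn.
have nM : M ^+ 2 <= n%:R.
  apply: (@le_trans _ _ (Num.truncn (M ^+ 2)).+1%:R); last by rewrite ler_nat.
  by apply/ltW/truncnS_gt.
have M0 : 0 < M by lra.
have n1 : (1 < n)%N.
  have : (4 : R) <= n%:R by apply: le_trans nM; rewrite expr2; nra.
  by rewrite ler_nat; apply: leq_trans.
have [F /andP[nF Fn]] := galois_field_between n1.
pose P : R := #|F|%:R.
have nP : n%:R <= P ^+ 2 by rewrite -natrX ler_nat.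
have Pn : P ^+ 2 <= 4 * n%:R by rewrite -natrX -natrM ler_nat.
have P0 : 0 < P := P_gt0 R F.
have MP : M <= P.
  by rewrite -ler_sqr ?nnegrE; [exact: le_trans nM nP|exact: ltW|exact: ltW].
have pP0 : 0 <= p * P by rewrite mulr_ge0 // ltW.
have /andP[s1 s2] := truncn_itv pP0.
set s := Num.truncn (p * P) in s1 s2.
have sF : (s <= #|F|)%N.
  by rewrite -(ler_nat R); apply: le_trans s1 _; rewrite ler_piMl // ltW.
have [|S [_ _ cS]] := @card_interpolate F set0 setT s (sub0set _).
  by rewrite cards0 cardsT.
have [g gI] : exists g : 'I_n -> F * F, injective g.
  have le : (n <= #|{: F * F}|)%N by rewrite card_prod mulnn.
  exists (fun i => enum_val (widen_ord le i)) => i j /enum_val_inj/(congr1 val)/= ij.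
  exact: val_inj.
pose r : rel 'I_n := fun x y => inc (g x) (g y) \in S.
exists (graph_of r) => A B.
have rs : symmetric r by move=> x y; rewrite /r incC.
pose N2 : R := kappa * n%:R ^+ 2.
have n0 : (0 : R) < n%:R by rewrite ltr0n ltnW.
have N20 : 0 <= N2 by rewrite mulr_ge0 ?exprn_ge0 ?ltW.
have cn (C : {set 'I_n}) : #|C|%:R <= n%:R :> R.
  by rewrite ler_nat -[leqRHS]card_ord max_card.
have cAB : #|A|%:R * #|B|%:R <= n%:R ^+ 2 :> R by rewrite expr2 ler_pM.
have dev : `|pairs (fun x y => deviation R S (inc (g x) (g y))) A B| <= N2.
  rewrite -ler_sqr ?nnegrE // real_normK ?num_real //.
  apply: le_trans (mixing R S A B gI) _; rewrite -/P /N2 exprMn.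
  rewrite -(ler_pM2l P0) -exprS.
  have -> : P ^+ 8 = (P ^+ 2) ^+ 4 by rewrite -exprM.
  apply: (@le_trans _ _ ((4 * n%:R) ^+ 4)).
    by apply: lerXn2r; rewrite ?nnegrE ?exprn_ge0 ?mulr_ge0 ?(ltW P0) ?(ltW n0).
  have -> : (4 * n%:R) ^+ 4 = 256 * n%:R ^+ 4 :> R by ring.
  have -> : P * (kappa ^+ 2 * (n%:R ^+ 2) ^+ 2) = P * kappa ^+ 2 * n%:R ^+ 4 by ring.
  apply: ler_wpM2r; first by rewrite exprn_ge0 // ltW.
  by rewrite -ler_pdivrMr //; exact: le_trans MP.
have kP : 1 <= kappa * P.
  by rewrite -ler_pdivrMl // mulr1; exact: le_trans MP.
have diag : `|pairs (fun x y => (adj (graph_of r) x y)%:R) A B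
     - pairs (fun x y => (r x y)%:R) A B| <= N2.
  rewrite /pairs -sumrB; apply: le_trans (ler_norm_sum _ _ _) _.
  apply: (@le_trans _ _ (\sum_(x in A) 1)).
    apply: ler_sum => x _; rewrite -sumrB; apply: le_trans (ler_norm_sum _ _ _) _.
    apply: (@le_trans _ _ (\sum_y (y == x)%:R)).
      rewrite big_mkcond; apply: ler_sum => y _; case: ifP => _; last exact: ler0n.
      rewrite adj_graph_of // eq_sym; case: eqP => _ /=; case: (r x y);
        by rewrite ?subrr ?subr0 ?sub0r ?normrN ?normr0 ?normr1.
    by rewrite (bigD1 x) //= eqxx big1 ?addr0 // => y /negPf->.
  rewrite sumr_const; apply: le_trans (cn A) _.
  rewrite /N2 expr2 mulrA ler_peMl ?(ltW n0) //.
  rewrite -ler_pdivrMl // mulr1; apply: le_trans M2 _; apply: le_trans nM.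
  by rewrite expr2 ler_peMl ?(ltW M0) //; lra.
have rho : `|(#|S|%:R / P - p) * (#|A|%:R * #|B|%:R)| <= N2.
  rewrite normrM [X in _ * X]ger0_norm ?mulr_ge0 //.
  apply: ler_pM; rewrite ?mulr_ge0 // cS.
  have -> : s%:R / P - p = (s%:R - p * P) / P by field; rewrite gt_eqF.
  rewrite normrM normfV (gtr0_norm P0) ler_pdivrMr //; apply: le_trans kP.
  by rewrite ler_norml; move: s2; rewrite -natr1 => s2; apply/andP; split; lra.
have E : pairs (fun x y => (r x y)%:R) A B =
   pairs (fun x y => deviation R S (inc (g x) (g y))) A B + #|S|%:R / P * (#|A|%:R * #|B|%:R).
  rewrite /pairs /deviation -/P.
  under [in RHS]eq_bigr do rewrite sumrB sumr_const.
  rewrite sumrB sumr_const -mulrnA -[_ *+ (_ * _)]mulr_natr natrM [#|B|%:R * _]mulrC.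
  by rewrite subrK.
move: diag dev rho; rewrite E !ler_norml => /andP[d1 d2] /andP[e1 e2] /andP[f1 f2].
rewrite -mulrA -/N2; apply/andP; split; lra.
Qed.

Lemma double_bin2 n : 2 * 'C(n, 2)%:R = n%:R * n%:R - n%:R :> R.
Proof.
have : (2 * 'C(n, 2) + n = n * n)%N.
  by rewrite -(mul_bin_diag n 1) bin1; case: n => // m; rewrite /= [RHS]mulnS addnC.
by move/(congr1 (fun m => m%:R : R)); rewrite natrD !natrM => <-; rewrite addrK.
Qed.

(** The approximate graph, tested on all vertices, has nearly the right number of edges, so
    correcting this number changes few pairs. *)
Lemma quasirandom (p kappa : R) : 0 <= p <= 1 -> 0 < kappa ->
  exists N : nat, forall n, (N <= n)%N ->
  exists G : sgraph 'I_n, #|edges G|%:Z = Num.floor (p * 'C(n, 2)%:R) /\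
  forall A B : {set 'I_n},
    `|pairs (fun x y => (adj G x y)%:R) A B - p * (#|A|%:R * #|B|%:R)| <= kappa * n%:R ^+ 2.
Proof.
(* The 7 is 3 from [quasirandom_approx] plus 4 from correcting the edge number. *)
move=> p01 k0; pose k' := kappa / 7; have k'0 : 0 < k' by rewrite divr_gt0.
have [N HN] := quasirandom_approx p01 k'0.
exists (maxn N (maxn 2 (Num.truncn (2 / k')).+1)) => n; rewrite !geq_max => /and3P[Nn n2 nk].
have [G0 G0P] := HN n Nn; case/andP: p01 => p0 p1.
have nk' : 2 / k' <= n%:R.
  apply: (@le_trans _ _ (Num.truncn (2 / k')).+1%:R); last by rewrite ler_nat.
  by apply/ltW/truncnS_gt.
have n0 : (0 : R) < n%:R by rewrite ltr0n; exact: leq_trans n2.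
have C2 := double_bin2 n.
have pC0 : 0 <= p * 'C(n, 2)%:R by rewrite mulr_ge0.
have /andP[k1 k2] := truncn_itv pC0.
set k := Num.truncn _ in k1 k2.
have kC : (k <= 'C(#|'I_n|, 2))%N.
  by rewrite card_ord -(ler_nat R); apply: le_trans k1 _; rewrite ler_piMl.
have [G [Gk Gd]] := adjust_edges G0 kC.
exists G; split.
  by apply/esym/floor_def; rewrite Gk addrC -intS; apply/andP.
pose N2 : R := k' * n%:R ^+ 2.
have E0 := G0P setT setT; rewrite pairs_setT_adj cardsT card_ord -mulrA -/N2 in E0.
have nN2 : 2 * n%:R <= N2.
  by rewrite /N2 expr2 mulrA ler_wpM2r ?(ltW n0) // mulrC -ler_pdivrMr.
have d : 2 * (edit_dist G G0)%:R <= 4 * N2.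
  rewrite Gd; have n2' : (2 : R) <= n%:R by rewrite ler_nat.
  move: E0; rewrite ler_norml => /andP[E1 E2].
  have pn : p * n%:R <= n%:R by rewrite ler_piMl // ltW.
  rewrite -natr1 in k2.
  have pC : 2 * (p * 'C(n, 2)%:R) = p * (n%:R * n%:R) - p * n%:R by rewrite mulrCA C2 mulrBr.
  have [h|h] := leqP k #|edges G0|.
    move: (h); rewrite -subn_eq0 => /eqP->; rewrite add0n natrB //.
    lra.
  move: (ltnW h); rewrite -subn_eq0 => /eqP->; rewrite addn0 natrB ?(ltnW h) //.
  have pn0 : 0 <= p * n%:R by rewrite mulr_ge0 // ltW.
  lra.
move=> A B; have := G0P A B; have := pairs_adj_edit G G0 A B.
have -> : kappa * n%:R ^+ 2 = 7 * N2 by rewrite /N2 /k'; field.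
rewrite -mulrA -/N2 !ler_norml => /andP[a1 a2] /andP[b1 b2].
by apply/andP; split; lra.
Qed.

End Quasirandom.

(** * From clusters to a coloured regularity graph *)

Lemma adj_K2 t (x y : 'I_2 + 'I_t) :
  adj (K2 t) x y = match x, y with inl _, inr _ | inr _, inl _ => true | _, _ => false end.
Proof.
have K (i : 'I_2) (j : 'I_t) : adj (K2 t) (inl i) (inr j) by exact: imset2_f.
case: x y => [i|j] [i'|j']; [ | exact: K | by rewrite adjC K | ].
  apply/negP => /imset2P[a b _ _ ab]; have : inr b \in [set inl i; inl i' : 'I_2 + 'I_t].
    by rewrite ab !inE eqxx orbT.
  by rewrite !inE.
apply/negP => /imset2P[a b _ _ ab]; have : inl a \in [set inr j; inr j' : 'I_2 + 'I_t].
  by rewrite ab !inE eqxx.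
by rewrite !inE.
Qed.

Section Clusters.
(* [A i] are the clusters and [B (i, a)] the [t] subclusters of [A i]. *)
Variables (R : realType) (T : finType) (G : sgraph T) (t q : nat).
Variables (eps delta : R) (A : 'I_q -> {set T}) (B : 'I_q * 'I_t -> {set T}).
Hypotheses (t4 : (4 <= t)%N) (eps0 : 0 < eps) (delta01 : 0 < delta <= 1 / 2).
Hypothesis eps4 : eps <= 1 / 4.
Hypothesis eps_small : (t + 3)%:R * eps <= (delta / 2 / 2) ^+ (t + 2).
Hypothesis B0 : forall k, (0 < #|B k|)%N.
Hypothesis Bdisj : forall k l x, x \in B k -> x \in B l -> k = l.
Hypothesis Bout : forall (i j : 'I_q) (a b : 'I_t) X Y, i != j ->
  large eps (B (i, a)) X -> large eps (B (j, b)) Y ->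
  `|edens R (adj G) X Y - edens R (adj G) (A i) (A j)| <= delta / 2.
Hypothesis Bin : forall (i : 'I_q) (a b : 'I_t), a != b ->
  regular eps (adj G) (B (i, a)) (B (i, b)).
Hypothesis noK : ~~ has_induced (K2 t) G.

Let dens i j := edens R (adj G) (A i) (A j).
Let joined (k l : 'I_q * 'I_t) := rich eps (delta / 2) (adj G) (B k) (B l).
Let apart (k l : 'I_q * 'I_t) := rich eps (delta / 2) (fun x y => ~~ adj G x y) (B k) (B l).

Lemma richC (e : rel T) (X Y : {set T}) : symmetric e ->
  rich eps (delta / 2) e X Y -> rich eps (delta / 2) e Y X.
Proof.
move=> es r U W hU hW.
have -> : pairs (fun x y => (e x y)%:R) U W = pairs (fun x y => (e x y)%:R) W U :> R.
  by rewrite pairsC; apply: eq_bigr => x _; apply: eq_bigr => y _; rewrite es.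
by rewrite [#|U|%:R * _]mulrC; exact: r.
Qed.

Lemma rich_eq (f g : T -> T -> bool) (X Y : {set T}) : (forall x y, f x y = g x y) ->
  rich eps (delta / 2) f X Y -> rich eps (delta / 2) g X Y.
Proof.
move=> fg r U W hU hW; apply: le_trans (r U W hU hW) _.
by rewrite /pairs; apply: ler_sum => x _; apply: ler_sum => y _; rewrite fg.
Qed.

(** The relation [h] demands agreement with [K2] on edges and on non-edges, so [rich_embedding]
    produces an induced copy. It is injective because the sets [B k] are disjoint. *)
Lemma no_embedding (phi : 'I_2 + 'I_t -> 'I_q * 'I_t) : injective phi ->
  (forall i j, joined (phi (inl i)) (phi (inr j))) ->
  apart (phi (inl ord0)) (phi (inl ord_max)) ->
  (forall j j', j != j' -> apart (phi (inr j)) (phi (inr j'))) -> False.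
Proof.
move=> phiI ju au aw; apply/negP: noK; rewrite negbK; apply/has_inducedP.
pose h (x y : 'I_2 + 'I_t) u v := adj G u v == adj (K2 t) x y.
have au' i i' : i != i' -> apart (phi (inl i)) (phi (inl i')).
  have apC k l : apart k l -> apart l k by apply: richC => x y; rewrite adjC.
  have o2 (l : 'I_2) : l = ord0 \/ l = ord_max.
    by case: l => [[|[|l]] hl] //; [left|right]; exact: val_inj.
  by case: (o2 i) => ->; case: (o2 i') => -> => //; move=> _; exact: apC.
have ju' i j : joined (phi (inr j)) (phi (inl i)).
  by apply: richC => [x y|]; [exact: adjC|exact: ju].
have /card_gt0P[T0 _] := B0 (phi (inl ord0)).
have [|||||||x [xB xh]] := @rich_embedding R T _ h (fun k => B (phi k)) eps (delta / 2)
   (enum {: 'I_2 + 'I_t}) 1 (fun k => B (phi k)) T0 eps0.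
- by case/andP: delta01 => d0 d1; apply/andP; split; lra.
- exact: enum_uniq.
- by move=> k _; exact: B0.
- move=> k l _ _ kl.
  rewrite /h; case: k l kl => [i|j] [i'|j'] kl; rewrite adj_K2.
  + have /au' : i != i' by apply: contraNneq kl => ->.
    by apply: rich_eq => x y; rewrite eqbF_neg.
  + by apply: rich_eq (ju i j') => x y; rewrite eqb_id.
  + by apply: rich_eq (ju' i' j) => x y; rewrite eqb_id.
  + have /aw : j != j' by apply: contraNneq kl => ->.
    by apply: rich_eq => x y; rewrite eqbF_neg.
- by move=> k l _ _ x y; rewrite /h adjC [adj (K2 t) _ _]adjC.
- rewrite -cardE card_sum !card_ord mul1r.
  by rewrite [(2 + t)%N]addnC addn2; move: eps_small; rewrite addn2 addn3.
- by move=> k _; rewrite /large subxx mul1r lexx.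
have mem k : k \in enum {: 'I_2 + 'I_t} by rewrite mem_enum.
exists x.
  move=> k l xkl; apply: phiI; apply: (Bdisj (xB k (mem k))); rewrite xkl; exact: xB.
move=> k l; have [->|kl] := eqVneq k l; first by rewrite !adjxx.
by have /eqP := xh k l (mem k) (mem l) kl.
Qed.

Lemma edens_pairs (e : rel T) (X Y : {set T}) :
  pairs (fun x y => (e x y)%:R) X Y = edens R e X Y * (#|X|%:R * #|Y|%:R).
Proof.
rewrite /edens /avg; have [X0|X0] := posnP #|X|.
  by rewrite X0 mul0r mulr0 /pairs big1 // => x; rewrite (card0_eq X0).
have [Y0|Y0] := posnP #|Y|.
  by rewrite Y0 !mulr0 /pairs big1 // => x _; rewrite big1 // => y; rewrite (card0_eq Y0).
by rewrite divfK // mulf_neq0 // pnatr_eq0 -lt0n.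
Qed.

Lemma joinedP k l :
  (forall X Y, large eps (B k) X -> large eps (B l) Y -> delta / 2 <= edens R (adj G) X Y) ->
  joined k l.
Proof. by move=> h X Y hX hY; rewrite edens_pairs ler_wpM2r ?mulr_ge0 // h. Qed.

Lemma apartP k l :
  (forall X Y, large eps (B k) X -> large eps (B l) Y -> edens R (adj G) X Y <= 1 - delta / 2) ->
  apart k l.
Proof.
move=> h X Y hX hY; have := h X Y hX hY.
have -> : pairs (fun x y => (~~ adj G x y)%:R) X Y =
    (1 - edens R (adj G) X Y) * (#|X|%:R * #|Y|%:R) :> R.
  rewrite mulrBl -edens_pairs mul1r.
  have -> : #|X|%:R * #|Y|%:R = \sum_(x in X) \sum_(y in Y) 1 :> R.
    by rewrite !sumr_const -mulrnA -natrM mulnC.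
  rewrite /pairs -sumrB; apply: eq_bigr => x _; rewrite -sumrB; apply: eq_bigr => y _.
  by case: (adj G x y); rewrite ?subrr ?subr0.
by move=> d; rewrite ler_wpM2r ?mulr_ge0 //; lra.
Qed.

(** Dense pairs satisfy [cluster_gray] too; [crg_weight] tests black first, and joining clusters
    only takes a lower bound on the density. *)
Definition cluster_gray i j := delta <= dens i j.
Definition cluster_black i j := 1 - delta < dens i j.
(* In a white cluster all [t] subclusters are pairwise sparse. *)
Definition cluster_vb i := [exists k : 'I_t * 'I_t,
  (k.1 != k.2) && (1 / 2 <= edens R (adj G) (B (i, k.1)) (B (i, k.2)))].

Lemma edensC X Y : edens R (adj G) X Y = edens R (adj G) Y X.
Proof.
rewrite /edens avgC /avg /pairs; congr (_ / _).
by apply: eq_bigr => x _; apply: eq_bigr => y _; rewrite adjC.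
Qed.

Lemma out_joined i j a b : i != j -> cluster_gray i j -> joined (i, a) (j, b).
Proof.
rewrite /cluster_gray => ij g; apply: joinedP => X Y hX hY; have := Bout ij hX hY.
by rewrite -/(dens i j) ler_norml => /andP[h1 h2]; lra.
Qed.

Lemma out_apart i j a b : i != j -> ~~ cluster_black i j -> apart (i, a) (j, b).
Proof.
rewrite /cluster_black -leNgt => ij g; apply: apartP => X Y hX hY; have := Bout ij hX hY.
by rewrite -/(dens i j) ler_norml => /andP[h1 h2]; lra.
Qed.

(** On large subsets the density is at most [1 / 2 + eps <= 3 / 4], and [delta <= 1 / 2] makes this
    at most [1 - delta / 2]. *)
Lemma white_apart (i : 'I_q) (a b : 'I_t) : ~~ cluster_vb i -> a != b -> apart (i, a) (i, b).
Proof.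
move=> /existsPn/(_ (a, b)) /=; rewrite negb_and => h ab.
move: h; rewrite ab /= -ltNge => h; apply: apartP => X Y hX hY; have := Bin ab hX hY.
move: delta01 => /andP[d0 d1]; rewrite ler_norml => /andP[_ h2].
rewrite lerBlDr in h2; apply: le_trans h2 _; apply: le_trans (lerD eps4 (ltW h)) _; lra.
Qed.

Lemma black_joined i : cluster_vb i -> exists a b, a != b /\ joined (i, a) (i, b).
Proof.
case/existsP => -[a b] /= /andP[ab d]; exists a, b; split=> //.
apply: joinedP => X Y hX hY; have := Bin ab hX hY.
move: delta01 => /andP[d0 d1]; rewrite ler_norml => /andP[h1 _].
rewrite lerBrDr addrC in h1; apply: le_trans h1;
apply: (@le_trans _ _ (1 / 2 - 1 / 4)); first by lra.
by apply: lerB; [exact: d|exact: eps4].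
Qed.

Lemma sum_inj (S : eqType) (f : 'I_2 -> S) (g : 'I_t -> S) :
  f ord0 != f ord_max -> injective g -> (forall i j, f i != g j) ->
  injective (fun x : 'I_2 + 'I_t => match x with inl i => f i | inr j => g j end).
Proof.
move=> f01 gI fg.
have o2 (l : 'I_2) : l = ord0 \/ l = ord_max.
  by case: l => [[|[|l]] hl] //; [left|right]; exact: val_inj.
case=> [i|j] [i'|j'].
- case: (o2 i) => ->; case: (o2 i') => -> //; last move/esym; by move/eqP; rewrite (negPf f01).
- by move/eqP; rewrite (negPf (fg _ _)).
- by move/esym/eqP; rewrite (negPf (fg _ _)).
- by move/gI ->.
Qed.

Lemma clusters_nonneg :
  (0 <= \sum_i \sum_j crg_weight t cluster_gray cluster_black cluster_vb i j)%R.
Proof.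
have grayC : symmetric cluster_gray by move=> i j; rewrite /cluster_gray /dens edensC.
have blackC : symmetric cluster_black by move=> i j; rewrite /cluster_black /dens edensC.
have t0 : (0 < t)%N by exact: leq_trans t4.
have t2 : (2 <= t)%N by exact: leq_trans t4.
pose o : 'I_t := Ordinal t0.
apply: crg_nonneg => //.
- move=> i j ij wi wj; apply/negP => g.
  pose u (l : 'I_2) := (i, widen_ord t2 l).
  pose v (l : 'I_t) := (j, l).
  apply: (@no_embedding (fun x => match x with inl l => u l | inr l => v l end)).
  + apply: sum_inj => [||l l'].
    * by apply/eqP => -[].
    * by move=> l l' [].
    * by apply/eqP => -[ji]; rewrite ji eqxx in ij.
  + by move=> l l'; exact: out_joined.
  + exact: white_apart.
  + by move=> l l' ll'; exact: white_apart.
- move=> w i j ww bi bj ij gi gj; apply: contraT => nb; exfalso.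
  have wi : w != i by apply: contraNneq ww => ->.
  have wj : w != j by apply: contraNneq ww => ->.
  pose u (l : 'I_2) := (if l == ord0 then i else j, o).
  pose v (l : 'I_t) := (w, l).
  apply: (@no_embedding (fun x => match x with inl l => u l | inr l => v l end)).
  + apply: sum_inj => [||l l'].
    * by apply/eqP => -[ji]; rewrite ji eqxx in ij.
    * by move=> l l' [].
    * by apply/eqP => -[]; rewrite /u; case: ifP => _ iw; rewrite iw eqxx in wi wj.
  + move=> l l'; rewrite /u; case: ifP => _; apply: out_joined; rewrite 1?eq_sym // 1?grayC //.
  + exact: out_apart.
  + by move=> l l' ll'; exact: white_apart.
- move=> i j S bi bj ij nb tS hS.
  (* Each black cluster gets an ordered pair of joined subclusters. The two-vertex side uses first
     entries and the [t]-side second ones, so a cluster may serve both sides. *)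
  have sel k : exists ab : 'I_t * 'I_t, cluster_vb k -> ab.1 != ab.2 /\ joined (k, ab.1) (k, ab.2).
    have [bk|_] := boolP (cluster_vb k); last by exists (o, o).
    by have [a [b ?]] := black_joined bk; exists (a, b).
  have [f fP] := choice sel.
  case: (pickP [pred kl : 'I_q * 'I_q |
      [&& kl.1 \in S, kl.2 \in S, kl.1 != kl.2 & cluster_black kl.1 kl.2]]).
    by move=> [k l] /and4P[]; exists k, l.
  move=> no; exfalso.
  pose m (l : 'I_t) := enum_val (widen_ord tS l).
  have mI : injective m by move=> l l' /enum_val_inj/(congr1 val)/= ?; exact: val_inj.
  have mS l : m l \in S by exact: enum_valP.
  pose u (l : 'I_2) := let k := if l == ord0 then i else j in (k, (f k).1).
  pose v (l : 'I_t) := (m l, (f (m l)).2).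
  have bm l : cluster_vb (m l) by have /and3P[] := hS _ (mS l).
  have bu l : cluster_vb (u l).1 by rewrite /u /=; case: ifP.
  apply: (@no_embedding (fun x => match x with inl l => u l | inr l => v l end)).
  + apply: sum_inj => [||l l'].
    * by apply/eqP => -[ji]; rewrite ji eqxx in ij.
    * by move=> l l' [] /mI.
    * apply/eqP => ul; have [/negP ne _] := fP _ (bu l); apply: ne.
      by have /= := congr1 snd ul; have /= := congr1 fst ul; rewrite /u /v /= => -> ->.
  + move=> l l'; have /and3P[_ mi mj] := hS _ (mS l').
    have : (m l' == (u l).1) || cluster_gray (m l') (u l).1 by rewrite /u /=; case: ifP.
    rewrite [u l]surjective_pairing /v; move: (bu l).
    have -> : (u l).2 = (f (u l).1).1 by [].
    case: (eqVneq (m l') (u l).1) => [-> bk _|ne _ /= g]; first by have [] := fP _ bk.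
    by apply: out_joined; [rewrite eq_sym|rewrite grayC].
  + exact: out_apart.
  + move=> l l' ll'; apply: out_apart; first by rewrite (inj_eq mI).
    by have := no (m l, m l'); rewrite /= !mS (inj_eq mI) ll' /= => ->.
Qed.

End Clusters.

(** * Lower bound *)

Lemma disjoint_blocks (T : finType) (k m : nat) (A : {set T}) : (k * m <= #|A|)%N ->
  exists V : 'I_k -> {set T}, [/\ forall i, V i \subset A, forall i, #|V i| = m &
    forall i j x, x \in V i -> x \in V j -> i = j].
Proof.
elim: k A => [|k IH] A kA; first by exists (fun=> set0); split=> -[].
have [|C [_ CA Cm]] := @card_interpolate _ set0 A m (sub0set _).
  by rewrite cards0 /=; apply: leq_trans kA; rewrite mulSn leq_addr.
have [|V [VA Vm Vd]] := IH (A :\: C).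
  rewrite cardsD (setIidPr CA) Cm; move: kA; rewrite mulSn => kA.
  by rewrite leq_subRL // (leq_trans _ kA) // leq_addr.
exists (fun i => if unlift ord0 i is Some j then V j else C); split.
- move=> i; case: unliftP => // j _; apply: subset_trans (VA j) _; exact: subsetDl.
- by move=> i; case: unliftP => // j _.
- move=> i j x; case: unliftP => [i'|] ->; case: unliftP => [j'|] -> //.
  + by move=> xi xj; rewrite (Vd i' j' x).
  + by move=> /(subsetP (VA _)); rewrite inE => /andP[/negPf->].
  + by move=> xC /(subsetP (VA _)); rewrite inE xC.
Qed.

Section Lower.
Variable R : realType.

Lemma sum_blocks_le (I T : finType) (V : I -> {set T}) (g : T -> R) :
  (forall i j x, x \in V i -> x \in V j -> i = j) -> (forall x, 0 <= g x) ->
  \sum_i \sum_(x in V i) g x <= \sum_x g x.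
Proof.
move=> Vd g0; under eq_bigr do rewrite big_mkcond.
rewrite exchange_big /=; apply: ler_sum => x _.
have [i xi|no] := pickP (fun i => x \in V i); last first.
  by rewrite big1 // => i _; rewrite no.
rewrite (bigD1 i) //= xi big1 ?addr0 // => j ji; case: ifP => // xj.
by rewrite (Vd _ _ _ xi xj) eqxx in ji.
Qed.

Section Cost.
Variables (T : finType) (G G' : sgraph T).

Let D (x y : T) : R := (adj G x y (+) adj G' x y)%:R.

Lemma edit_avg_ge (A B : {set T}) :
  `|edens R (adj G) A B - edens R (adj G') A B| <= avg D A B.
Proof.
rewrite /edens /avg -mulrBl normrM [X in _ * X]ger0_norm ?invr_ge0 ?mulr_ge0 //.
rewrite ler_wpM2r ?invr_ge0 ?mulr_ge0 // /pairs -sumrB.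
apply: le_trans (ler_norm_sum _ _ _) _; apply: ler_sum => x _; rewrite -sumrB.
apply: le_trans (ler_norm_sum _ _ _) _; apply: ler_sum => y _; rewrite /D.
by case: (adj G x y); case: (adj G' x y); rewrite /= ?subrr ?subr0 ?sub0r ?normrN ?normr0 ?normr1.
Qed.

Lemma edit_avg_blocks (q m : nat) (V : 'I_q -> {set T}) :
  (forall i, #|V i| = m) -> (forall i j x, x \in V i -> x \in V j -> i = j) ->
  (0 < m)%N ->
  m%:R ^+ 2 * (\sum_i \sum_(j | j != i) avg D (V i) (V j)) <= 2 * (edit_dist G G')%:R.
Proof.
move=> Vm Vd m0.
have D0 x y : 0 <= D x y by exact: ler0n.
apply: (@le_trans _ _ (\sum_i \sum_(x in V i) \sum_j \sum_(y in V j) D x y)).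
  rewrite mulr_sumr; apply: ler_sum => i _; rewrite mulr_sumr exchange_big /=.
  rewrite [leRHS](bigID (fun j => j != i)) /= -[leLHS]addr0 lerD //; last first.
    by do 3!apply: sumr_ge0 => ? _.
  apply: ler_sum => j _; rewrite /avg !Vm -expr2 mulrCA mulfV ?mulr1 //.
  by rewrite expf_neq0 // pnatr_eq0 -lt0n.
have -> : 2 * (edit_dist G G')%:R = \sum_x \sum_y D x y.
  rewrite -natrM mul2n -sum_edit natr_sum; apply: eq_bigr => x _.
  by rewrite natr_sum.
apply: (@le_trans _ _ (\sum_i \sum_(x in V i) \sum_y D x y)).
  by apply: ler_sum => i _; apply: ler_sum => x _; exact: sum_blocks_le.
by apply: sum_blocks_le => // x; apply: sumr_ge0.
Qed.

End Cost.

(** Off the diagonal [F i j >= c * (1 + M i j) - d]: the right side is at most 0 for gray pairs,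
    [1 - p - d] for black and [2 * c - d <= p - d] for white ones. This reduces every admissible [p]
    to the critical weights; each diagonal entry loses at most [c * t]. *)
Lemma crg_cost (p c d : R) (t q : nat) (F : 'I_q -> 'I_q -> R)
    (gray black : rel 'I_q) (vb : pred 'I_q) :
  (4 <= t)%N -> 0 <= c <= 1 -> 2 * c <= p -> c * (t%:R - 1) = 1 - p ->
  0 <= \sum_i \sum_j crg_weight t gray black vb i j ->
  (forall i j, i != j -> 0 <= F i j) ->
  (forall i j, i != j -> black i j -> 1 - p - d <= F i j) ->
  (forall i j, i != j -> ~~ black i j -> ~~ gray i j -> p - d <= F i j) ->
  0 <= d ->
  c * (q%:R ^+ 2 - t%:R * q%:R) - d * q%:R ^+ 2 <= \sum_i \sum_(j | j != i) F i j.
Proof.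
move=> t4 /andP[c0 c1] cp ct M0 F0 Fb Fw d0.
pose M i j : R := (crg_weight t gray black vb i j)%:~R.
have sM : 0 <= \sum_i \sum_j M i j.
  have -> : \sum_i \sum_j M i j = (\sum_i \sum_j crg_weight t gray black vb i j)%:~R.
    by rewrite rmorph_sum; apply: eq_bigr => i _; rewrite rmorph_sum.
  by rewrite ler0z.
have t4' : (4 : R) <= t%:R by rewrite ler_nat.
have Mle i j : 1 + M i j <= t%:R.
  rewrite /M /crg_weight; do ![case: ifP => _]; rewrite ?rmorphB ?rmorphN /=; lra.
have cell i j :
    c * (1 + M i j) - (if j == i then c * t%:R else 0) - d <= (if j != i then F i j else 0).
  have [->|ji] /= := eqVneq j i.
    have := ler_wpM2l c0 (Mle i i); lra.
  have ij : i != j by rewrite eq_sym.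
  rewrite /M /crg_weight (negPf ij); case: ifP => [b|/negbT b].
    have := Fb i j ij b; rewrite rmorphB /=; lra.
  case: ifP => [g|/negbT g]; first by have := F0 i j ij; rewrite rmorphN /=; lra.
  have := Fw i j ij b g; rewrite /=; lra.
apply: (@le_trans _ _ (\sum_i \sum_j (c * (1 + M i j) - (if j == i then c * t%:R else 0) - d))).
  have -> : \sum_i \sum_j (c * (1 + M i j) - (if j == i then c * t%:R else 0) - d) =
     c * (\sum_i \sum_j M i j) + \sum_(i < q) \sum_(j < q) (c - d) - \sum_(i < q) c * t%:R.
    rewrite mulr_sumr -big_split /= -sumrB; apply: eq_bigr => i _.
    rewrite mulr_sumr -big_split /=.
    have E : \sum_(j < q) (if j == i then c * t%:R else 0) = c * t%:R.
      by rewrite -big_mkcond big_pred1_eq.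
    by rewrite -[X in _ = _ - X]E -sumrB; apply: eq_bigr => j _; case: ifP => _; ring.
  rewrite !sumr_const !card_ord -!mulrnA -[_ *+ (q * q)]mulr_natr -[_ *+ q]mulr_natr natrM.
  have := mulr_ge0 c0 sM; lra.
apply: ler_sum => i _; rewrite [leRHS]big_mkcond; apply: ler_sum => j _; exact: cell.
Qed.

Lemma large_trans (T : finType) (a b : R) (X Y Z : {set T}) : 0 <= b ->
  large a X Y -> large b Y Z -> large (b * a) X Z.
Proof.
move=> b0 /andP[YX aY] /andP[ZY bZ]; rewrite /large (subset_trans ZY YX) /=.
by apply: le_trans bZ; rewrite -mulrA ler_wpM2l.
Qed.

Lemma large_le (T : finType) (a b : R) (X Y : {set T}) : a <= b -> large b X Y -> large a X Y.
Proof.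
move=> ab /andP[YX bY]; rewrite /large YX /=; apply: le_trans bY.
by rewrite ler_wpM2r.
Qed.

Lemma cost_black (p delta x y F : R) :
  `|x - p| <= delta -> `|x - y| <= F -> 1 - delta < y -> 1 - p - 2 * delta <= F.
Proof. by rewrite !ler_norml => /andP[? ?] /andP[? ?] ?; lra. Qed.

Lemma cost_white (p delta x y F : R) :
  `|x - p| <= delta -> `|x - y| <= F -> y < delta -> p - 2 * delta <= F.
Proof. by rewrite !ler_norml => /andP[? ?] /andP[? ?] ?; lra. Qed.

(** Half of [gamma] pays for the diagonal (1/8), for [delta] (1/4) and for the regularity error
    (1/8); the other half pays for the vertices outside the [q] blocks. *)
Lemma lower_arith (c gamma delta t q m n S : R) :
  0 <= c -> c <= 1 -> 0 < gamma -> delta <= gamma / 8 -> 0 <= t -> 8 * t <= gamma * q ->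
  1 <= q -> 1 <= m -> 4 * q <= gamma * n -> q * m <= n -> n <= m * q + q ->
  c * (q ^+ 2 - t * q) - 2 * delta * q ^+ 2 <= S + gamma / 8 -> 0 < c - gamma ->
  (c - gamma) * n ^+ 2 <= m ^+ 2 * S.
Proof.
move=> c0 c1 g0 dg t0 tq q1 m1 qn qm nm cS pos.
have q0 : 0 < q by lra.
have qn' : q <= n by apply: le_trans qm; rewrite ler_peMr // ltW.
have n0 : 0 <= n by lra.
have eta0 : 0 < gamma / 8 by lra.
have SS : q ^+ 2 * (c - gamma / 2) <= S.
  have h1 : c * (t * q) <= gamma / 8 * q ^+ 2.
    apply: (@le_trans _ _ (1 * (t * q))).
      by rewrite ler_wpM2r // mulr_ge0 // ltW.
    rewrite mul1r expr2 mulrA ler_wpM2r ?(ltW q0) //; lra.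
  have h2 : delta * q ^+ 2 <= gamma / 8 * q ^+ 2 by rewrite ler_wpM2r // exprn_ge0 // ltW.
  have h3 : gamma / 8 <= gamma / 8 * q ^+ 2.
    by rewrite ler_peMr ?(ltW eta0) // expr2 -[leLHS]mulr1 ler_pM.
  lra.
apply: (@le_trans _ _ (m ^+ 2 * (q ^+ 2 * (c - gamma / 2)))); last first.
  by rewrite ler_wpM2l // sqr_ge0.
rewrite mulrA -exprMn.
have h : n ^+ 2 - 2 * (q * n) <= (m * q) ^+ 2.
  have h1 : (n - q) ^+ 2 <= (m * q) ^+ 2.
    by rewrite ler_sqr ?nnegrE ?mulr_ge0 //; lra.
  apply: le_trans h1; rewrite sqrrB; have := sqr_ge0 q; lra.
have cg : 0 <= c - gamma / 2 by lra.
apply: le_trans (ler_wpM2r cg h).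
have h4 : 4 * (q * n) <= gamma * n ^+ 2 by rewrite expr2 !mulrA ler_wpM2r.
have h5 : q * n * (c - gamma / 2) <= q * n * 1.
  by rewrite ler_wpM2l ?mulr_ge0 ?(ltW q0) //; lra.
lra.
Qed.

Lemma lower_bound (t : nat) (p gamma : R) : (4 <= t)%N -> 0 <= p <= 1 ->
  2 / (t%:R + 1) <= p -> 0 < gamma ->
  exists N : nat, forall n, (N <= n)%N ->
  exists G : sgraph 'I_n, #|edges G|%:Z = Num.floor (p * 'C(n, 2)%:R) /\
  forall G' : sgraph 'I_n, ~~ has_induced (K2 t) G' ->
    ((1 - p) / (t%:R - 1) - gamma) * n%:R ^+ 2 <= 2 * (edit_dist G G')%:R.
Proof.
move=> t4 p01 pt gamma0; set c := (1 - p) / (t%:R - 1).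
have /andP[p0 p1] := p01.
have t4' : (4 : R) <= t%:R by rewrite ler_nat.
have t1 : 0 < t%:R - 1 :> R by lra.
have ct : c * (t%:R - 1) = 1 - p by rewrite divfK // gt_eqF.
have c0 : 0 <= c by apply: divr_ge0; [rewrite subr_ge0|exact: ltW].
have c1 : c <= 1 by rewrite ler_pdivrMr //; lra.
(* This is the hypothesis [2 / (t + 1) <= p] rewritten. *)
have cp : 2 * c <= p.
  have pt' : 2 <= p * (t%:R + 1) by rewrite -ler_pdivrMr //; lra.
  by rewrite /c mulrA ler_pdivrMr //; lra.
(* The constants are chosen in the order [delta], [eps1], [delta_in], [eps2], [q], [delta_out],
   [kappa], each from [gamma], [p], [t] and earlier ones. *)
pose delta := Num.min (1 / 2) (gamma / 8).
have delta0 : 0 < delta by rewrite lt_min; apply/andP; split; lra.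
have delta1 : delta <= 1 / 2 by rewrite ge_min lexx.
have delta2 : delta <= gamma / 8 by rewrite ge_min lexx orbT.
pose eps1 := Num.min (1 / 4) ((delta / 2 / 2) ^+ (t + 2) / (t + 3)%:R).
have eps10 : 0 < eps1.
  rewrite lt_min; apply/andP; split; first by lra.
  by apply: divr_gt0; [apply: exprn_gt0; lra|rewrite ltr0n addn3].
have eps14 : eps1 <= 1 / 4 by rewrite ge_min lexx.
have eps1s : (t + 3)%:R * eps1 <= (delta / 2 / 2) ^+ (t + 2).
  by rewrite mulrC -ler_pdivlMr ?ltr0n ?addn3 // -addn3 ge_min lexx orbT.
have [delta_in din0 inP] := regularity 'I_t eps10 (ltr01 : (0 : R) < 1).
(* An [eps1]-large part of a subcluster must be [eps2]-large in its cluster; the factor 2 in [2 * t]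
   covers the rounding of the block size. *)
pose eps2 := Num.min (delta / 4) (eps1 * (delta_in * (2 * t%:R)^-1)).
have tt0 : 0 < (2 * t%:R)^-1 :> R by rewrite invr_gt0; lra.
have eps20 : 0 < eps2 by rewrite lt_min !mulr_gt0 //; lra.
have eps2d : eps2 <= delta / 4 by rewrite ge_min lexx.
have eps2s : eps2 <= eps1 * (delta_in * (2 * t%:R)^-1) by rewrite ge_min lexx orbT.
pose q := (Num.truncn (8 * t%:R / gamma)).+1.
have qg : 8 * t%:R <= gamma * q%:R.
  by rewrite [gamma * _]mulrC -ler_pdivrMr //; apply/ltW/truncnS_gt.
have q0 : 0 < q%:R :> R by rewrite ltr0n.
have eta0 : 0 < gamma / 8 by rewrite divr_gt0.
have [delta_out dout0 outP] := regularity 'I_q eps20 eta0.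
(* Clusters have at least [delta_out * n / (2 * q)] vertices, so the quasirandom error is at most
   [delta] in density. *)
pose kappa := delta * (delta_out / (2 * q%:R)) ^+ 2.
have kappa0 : 0 < kappa by rewrite mulr_gt0 // exprn_gt0 // divr_gt0 // mulr_gt0.
have [Nqr qrP] := quasirandom p01 kappa0.
(* Blocks of size at least [u] leave clusters of at least [t] vertices, enough for [t] nonempty
   subblocks. *)
pose u := (Num.truncn (t%:R / delta_out)).+1.
exists (maxn Nqr (maxn (u * q) (Num.truncn (4 * q%:R / gamma)).+1)) => n.
rewrite !geq_max => /and3P[nqr nu nq].
have [G [Gedges GP]] := qrP n nqr; exists G; split=> // G' forbG'.
have nq' : 4 * q%:R <= gamma * n%:R.
  rewrite [gamma * _]mulrC -ler_pdivrMr //;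
  apply: (@le_trans _ _ (Num.truncn (4 * q%:R / gamma)).+1%:R).
    by apply/ltW/truncnS_gt.
  by rewrite ler_nat.
pose m := (n %/ q)%N.
have um : (u <= m)%N by rewrite leq_divRL.
have m0 : (0 < m)%N by exact: leq_trans um.
have m0' : 0 < m%:R :> R by rewrite ltr0n.
have mdelta : t%:R <= delta_out * m%:R.
  rewrite mulrC -ler_pdivrMr //; apply: (@le_trans _ _ u%:R); last by rewrite ler_nat.
  by apply/ltW/truncnS_gt.
have nm : n%:R <= m%:R * q%:R + q%:R :> R.
  rewrite -natrM -natrD ler_nat {1}(divn_eq n q) leq_add2l ltnW //.
  by rewrite ltn_mod.
have qm : q%:R * m%:R <= n%:R :> R by rewrite -natrM ler_nat mulnC leq_divM.
have [|V [_ Vm Vd]] := @disjoint_blocks 'I_n q m setT.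
  by rewrite cardsT card_ord mulnC leq_divM.
pose D (x y : 'I_n) : R := (adj G x y (+) adj G' x y)%:R.
have D01 x y : 0 <= D x y <= 1 by rewrite /D; case: (_ (+) _); rewrite ?lexx ?ler01.
have V0 i : (0 < #|V i|)%N by rewrite Vm.
have [A [AV Areg Acost]] := outP _ (adj G') D V D01 V0.
have Ad i j x : x \in A i -> x \in A j -> i = j.
  have /andP[/subsetP si _] := AV i; have /andP[/subsetP sj _] := AV j.
  by move=> /si xi /sj xj; exact: Vd xi xj.
have Am i : delta_out * m%:R <= #|A i|%:R by have /andP[_] := AV i; rewrite Vm.
have At i : (t <= #|A i|)%N by rewrite -(ler_nat R); exact: le_trans (Am i).
have inner i : exists B : 'I_t -> {set 'I_n},
    [/\ forall a, large (delta_in * (2 * t%:R)^-1) (A i) (B a),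
        forall a, (0 < #|B a|)%N,
        forall a b, a != b -> regular eps1 (adj G') (B a) (B b) &
        forall a b x, x \in B a -> x \in B b -> a = b].
  pose f := (#|A i| %/ t)%N.
  have [|W [WA Wf Wd]] := @disjoint_blocks _ t f (A i).
    by rewrite mulnC leq_divM.
  have f0 : (0 < f)%N by rewrite divn_gt0 // (leq_trans _ t4).
  have W0 a : (0 < #|W a|)%N by rewrite Wf.
  (* The cost function is 0, as edits inside a cluster are not charged. *)
  have [|B [BW Breg _]] := inP _ (adj G') (fun _ _ => 0) W _ W0.
    by move=> x y; rewrite lexx ler01.
  exists B; split=> //.
  - move=> a; apply: large_trans (ltW din0) _ (BW a).
    rewrite /large WA Wf /= mulrC ler_pdivrMr; last by rewrite mulr_gt0 // ltr0n (leq_trans _ t4).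
    rewrite mulrCA -!natrM ler_nat (divn_eq #|A i| t) -/f mul2n -addnn leq_add2l.
    apply: (@leq_trans t); last by rewrite leq_pmull.
    by apply/ltnW; rewrite ltn_mod (leq_trans _ t4).
  - move=> a; have /andP[_ Ba] := BW a; rewrite -(ltr0n R); apply: lt_le_trans Ba.
    by rewrite mulr_gt0 // ltr0n.
  - move=> a b x; have /andP[/subsetP sa _] := BW a; have /andP[/subsetP sb _] := BW b.
    by move=> /sa xa /sb xb; exact: Wd xa xb.
have [B BP] := choice inner.
pose Bk (k : 'I_q * 'I_t) := B k.1 k.2.
have Bout (i j : 'I_q) (a b : 'I_t) X Y : i != j ->
  large eps1 (Bk (i, a)) X -> large eps1 (Bk (j, b)) Y ->
  `|edens R (adj G') X Y - edens R (adj G') (A i) (A j)| <= delta / 2.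
  have sub k l Z : large eps1 (Bk (k, l)) Z -> large eps2 (A k) Z.
    move=> hZ; apply: large_le eps2s _; apply: large_trans (ltW eps10) _ hZ.
    by have [h _ _ _] := BP k; exact: h.
  move=> ij /sub hX /sub hY; apply: le_trans (Areg i j ij X Y hX hY) _.
  by lra.
have Bd k l x : x \in Bk k -> x \in Bk l -> k = l.
  case: k l => [i a] [j b]; rewrite /Bk /= => xi xj.
  have [/(_ a)/andP[/subsetP si _] _ _ _] := BP i.
  have [/(_ b)/andP[/subsetP sj _] _ _ _] := BP j.
  have ij := Ad _ _ _ (si _ xi) (sj _ xj); subst j; congr (_, _).
  by have [_ _ _ h] := BP i; exact: h xi xj.
have key : 0 <= \sum_i \sum_j crg_weight t
    (cluster_gray G' delta A) (cluster_black G' delta A) (cluster_vb R G' Bk) i j.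
  apply: (@clusters_nonneg R 'I_n G' t q eps1 delta A Bk) => //.
  - by rewrite delta0 delta1.
  - by move=> [i a]; have [_ h _ _] := BP i; exact: h.
  - by move=> i a b ab; have [_ _ h _] := BP i; exact: h.
have dG i j : `|edens R (adj G) (A i) (A j) - p| <= delta.
  have a0 k : 0 < #|A k|%:R :> R by rewrite ltr0n (leq_trans _ (At k)) // (leq_trans _ t4).
  have ab0 : 0 < #|A i|%:R * #|A j|%:R :> R by rewrite mulr_gt0.
  have -> : edens R (adj G) (A i) (A j) - p =
    (pairs (fun x y => (adj G x y)%:R) (A i) (A j) - p * (#|A i|%:R * #|A j|%:R))
      / (#|A i|%:R * #|A j|%:R).
    by rewrite mulrBl mulfK // gt_eqF.
  rewrite normrM normfV [X in _ / X]gtr0_norm // ler_pdivrMr //.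
  apply: le_trans (GP _ _) _; rewrite /kappa -mulrA ler_wpM2l ?(ltW delta0) //.
  have half : delta_out / (2 * q%:R) * n%:R <= delta_out * m%:R.
    rewrite -mulrA ler_wpM2l ?(ltW dout0) // mulrC ler_pdivrMr ?mulr_gt0 //.
    have : q%:R <= m%:R * q%:R :> R by rewrite ler_peMl ?(ltW q0) // ler1n.
    lra.
  rewrite -exprMn expr2; apply: ler_pM.
  - by rewrite mulr_ge0 ?divr_ge0 ?mulr_ge0 // ltW.
  - by rewrite mulr_ge0 ?divr_ge0 ?mulr_ge0 // ltW.
  - exact: le_trans half (Am i).
  - exact: le_trans half (Am j).
have cost : c * (q%:R ^+ 2 - t%:R * q%:R) - 2 * delta * q%:R ^+ 2 <=
    \sum_i \sum_(j | j != i) avg D (A i) (A j).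
  apply: (crg_cost t4 _ cp ct key); first by rewrite c0.
  - by move=> i j _; case/andP: (avg_01 (A i) (A j) D01).
  - by move=> i j _; exact: cost_black (dG i j) (edit_avg_ge G G' (A i) (A j)).
  - move=> i j _ _; rewrite /cluster_gray -ltNge.
    exact: cost_white (dG i j) (edit_avg_ge G G' (A i) (A j)).
  - by rewrite mulr_ge0 // ltW.
have blocks := edit_avg_blocks G G' Vm Vd m0.
have [neg|pos] := lerP (c - gamma) 0.
  apply: (@le_trans _ _ 0); last by rewrite mulr_ge0.
  by rewrite mulr_le0_ge0 // exprn_ge0.
apply: le_trans blocks.
set S := \sum_i \sum_(j | _) avg _ (V i) (V j) in Acost *.
apply: (@lower_arith c gamma delta t%:R q%:R) => //; rewrite ?ler1n //; lra.
Qed.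

End Lower.

(** * Upper bound and limit *)

Lemma bigminn_le (I : eqType) (r : seq I) (P : pred I) (F : I -> nat) d i :
  i \in r -> P i -> (\big[minn/d]_(j <- r | P j) F j <= F i)%N.
Proof.
elim: r => // a r IH; rewrite inE big_cons => /predU1P[<-|ir] Pi.
  by rewrite Pi geq_minl.
by case: ifP => _; rewrite ?geq_min IH ?orbT.
Qed.

Section Upper.
Variable T : finType.

(** Shifting the colour of [x] by [c] modulo [s.+1] permutes the colourings, and for each colouring
    exactly one shift gives [x] the colour of [y]. *)
Lemma sum_eq_colour (s : nat) (x y : T) : x != y ->
  ((\sum_(f : {ffun T -> 'I_s.+1}) (f x == f y)) * s.+1 = #|{ffun T -> 'I_s.+1}|)%N.
Proof.
move=> xy; have yx : (y == x) = false by rewrite eq_sym (negPf xy).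
pose h (c : 'I_s.+1) (f : {ffun T -> 'I_s.+1}) := [ffun z => if z == x then f x + c else f z].
have hK c : cancel (h c) (h (- c)).
  by move=> f; apply/ffunP => z; rewrite !ffunE eqxx; case: eqP => [->|//]; rewrite addrK.
have hK' c : cancel (h (- c)) (h c) by move=> f; rewrite -{1}[c]opprK hK.
transitivity (\sum_(c : 'I_s.+1) \sum_(f : {ffun T -> 'I_s.+1}) ((f x + c)%R == f y))%N.
  transitivity (\sum_(c : 'I_s.+1) \sum_(f : {ffun T -> 'I_s.+1}) (f x == f y))%N.
    by rewrite sum_nat_const card_ord mulnC.
  apply: eq_bigr => c _.
  have hb : bijective (h c) by exists (h (- c)); [exact: hK|exact: hK'].
  rewrite (reindex (h c)) /=; last exact: onW_bij.
  by apply: eq_bigr => f _; rewrite !ffunE eqxx yx.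
rewrite exchange_big /= -sum1_card; apply: eq_bigr => f _.
rewrite (bigD1 (f y - f x)%R) //= [(f y - f x)%R]addrC addrA subrr add0r eqxx.
rewrite big1 ?addn0 // => c ne; case: eqP => // fc; case/eqP: ne.
by rewrite -fc addKr.
Qed.

Variable G : sgraph T.

Lemma sum_neq : (\sum_(x : T) \sum_(y : T) (x != y) = 'C(#|T|, 2).*2)%N.
Proof.
rewrite -card_pairs_set -(sum_pairs_edges (subxx _)); apply: eq_bigr => x _.
by apply: eq_bigr => y _; rewrite inE cards2; case: (x != y).
Qed.

Lemma sum_nonadj : (\sum_x \sum_y ((x != y) && ~~ adj G x y) + #|edges G|.*2 = 'C(#|T|, 2).*2)%N.
Proof.
rewrite -sum_adj -sum_neq -big_split; apply: eq_bigr => x _; rewrite -big_split.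
apply: eq_bigr => y _; have [->|xy] /= := eqVneq x y; first by rewrite adjxx.
by case: (adj G x y).
Qed.

Lemma forb_near (t : nat) : (2 <= t)%N ->
  exists G' : sgraph T, ~~ has_induced (K2 t) G' /\
    (edit_dist G G' * t.-1 + #|edges G| <= 'C(#|T|, 2))%N.
Proof.
case: t => [|[|s]] // _; rewrite -[s.+2.-1]/s.+1.
pose N := (\sum_x \sum_y ((x != y) && ~~ adj G x y))%N.
pose W (f : {ffun T -> 'I_s.+1}) := (\sum_x \sum_y [&& x != y, ~~ adj G x y & f x == f y])%N.
(* There are [t - 1] colours, [t] being [s.+2]; some colouring does at least as well as the average
   one. *)
have [f Wf] : exists f, (W f * s.+1 <= N)%N.
  have [f Wf|no] := pickP (fun f => W f * s.+1 <= N)%N; first by exists f.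
  have : (N.+1 * #|{ffun T -> 'I_s.+1}| <= \sum_f W f * s.+1)%N.
    rewrite mulnC -sum_nat_const; apply: leq_sum => f _.
    by have := no f; rewrite leqNgt => /negbFE.
  have -> : (\sum_f W f * s.+1 = N * #|{ffun T -> 'I_s.+1}|)%N.
    rewrite -big_distrl /W exchange_big /= !big_distrl /=; apply: eq_bigr => x _.
    rewrite exchange_big /= !big_distrl /=; apply: eq_bigr => y _.
    have [->|xy] /= := eqVneq x y; first by rewrite big1.
    case: (adj G x y) => /=; first by rewrite big1.
    by rewrite sum_eq_colour // mul1n.
  by rewrite leq_pmul2r ?ltnn //; apply/card_gt0P; exists [ffun=> ord0].
pose r x y := adj G x y || (f x == f y).
have rs : symmetric r by move=> x y; rewrite /r adjC eq_sym.
exists (graph_of r); split.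
  apply/negP => /has_inducedP[g gI gE].
  (* Pigeonhole: two of the [t] independent vertices share a colour and so are adjacent. *)
  have : (#|'I_s.+1| < #|'I_s.+2|)%N by rewrite !card_ord.
  have [|/injectivePn[i [j ij fij]]] := boolP (injectiveb (fun i : 'I_s.+2 => f (g (inr i)))).
    by move/injectiveP/leq_card; rewrite !card_ord ltnn.
  move=> _; have := gE (inr i) (inr j); rewrite adj_K2 adj_graph_of // /r fij eqxx orbT andbT.
  by rewrite (inj_eq gI) => /negbFE/eqP[ij']; rewrite ij' eqxx in ij.
have -> : (edit_dist G (graph_of r) * s.+1 + #|edges G| <= 'C(#|T|, 2))%N =
   ((edit_dist G (graph_of r)).*2 * s.+1 + #|edges G|.*2 <= 'C(#|T|, 2).*2)%N.
  by rewrite -doubleMl -doubleD leq_double.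
rewrite -sum_nonadj leq_add2r -sum_edit; apply: leq_trans Wf.
rewrite leq_mul2r; apply/orP; right; apply: leq_sum => x _; apply: leq_sum => y _.
rewrite adj_graph_of // /r; have [->|xy] /= := eqVneq x y; first by rewrite adjxx.
by case: (adj G x y); case: (f x == f y).
Qed.

End Upper.

(** * Convergence of the edit ratio *)

Section Limit.
Variables (R : realType) (t : nat) (p : R).
Hypotheses (t4 : (4 <= t)%N) (p01 : 0 <= p <= 1) (pt : 2 / (t%:R + 1) <= p).

Let c : R := (1 - p) / (t%:R - 1).

(** The second term pays for the floor, which lowers the edge number by less than 1. *)
Lemma edit_ratio_le n : (1 < n)%N ->
  edit_ratio (Forb (K2 t)) p n <= c + 'C(n, 2)%:R^-1.
Proof.
move=> n1; have C0 : 0 < 'C(n, 2)%:R :> R by rewrite ltr0n bin_gt0.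
have t4' : (4 : R) <= t%:R by rewrite ler_nat.
rewrite /edit_ratio ler_pdivrMr // mulrDl mulVf ?gt_eqF //.
set K : R := c * _ + 1.
suff : forall G : sgraph 'I_n, #|edges G|%:Z == Num.floor (p * 'C(n, 2)%:R) ->
    (edit_dist_to (Forb (K2 t)) G)%:R <= K.
  move=> h; apply: (big_ind (fun k : nat => k%:R <= K)) => //.
  - apply: addr_ge0 => //; apply: mulr_ge0; last exact: ltW.
    by case/andP: p01 => _ p1; apply: divr_ge0; lra.
  - by move=> a b ha hb; rewrite /maxn; case: ifP.
move=> G /eqP Ge; have [G' [G'f G'd]] := forb_near G (leq_trans (isT : 2 <= 4)%N t4).
apply: (@le_trans _ _ (edit_dist G G')%:R).
  by rewrite ler_nat; apply: bigminn_le => //; rewrite mem_index_enum.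
have e1 : p * 'C(n, 2)%:R < #|edges G|%:R + 1.
  have := floorD1_gt (p * 'C(n, 2)%:R); rewrite -Ge.
  by rewrite intrD.
rewrite card_ord -(ler_nat R) natrD natrM in G'd.
have tp : (t.-1)%:R = t%:R - 1 :> R by rewrite -subn1 natrB // (leq_trans _ t4).
rewrite tp in G'd.
have ct : c * (t%:R - 1) = 1 - p by rewrite /c divfK // gt_eqF //; lra.
rewrite -(@ler_pM2r _ (t%:R - 1)); last by lra.
rewrite /K mulrDl mulrAC ct; lra.
Qed.

Lemma edit_ratio_ge (gamma : R) : 0 < gamma -> exists N, forall n, (N <= n)%N ->
  c - gamma <= edit_ratio (Forb (K2 t)) p n.
Proof.
move=> g0; have [N HN] := lower_bound t4 p01 pt g0.
have t4' : (4 : R) <= t%:R by rewrite ler_nat.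
exists (maxn N 2) => n; rewrite geq_max => /andP[Nn n2].
have [G [Ge GP]] := HN n Nn.
have C0 : 0 < 'C(n, 2)%:R :> R by rewrite ltr0n bin_gt0.
have c1 : c <= 1 by rewrite /c ler_pdivrMr; case/andP: p01 => ? ?; lra.
rewrite /edit_ratio ler_pdivlMr //.
apply: (@le_trans _ _ (edit_dist_to (Forb (K2 t)) G)%:R); last first.
  by rewrite ler_nat; apply: leq_bigmax_cond; apply/eqP.
have [neg|pos] := lerP (c - gamma) 0.
  by apply: (@le_trans _ _ 0); rewrite // mulr_le0_ge0 // ltW.
(* The default value of the minimum satisfies the bound because [c - gamma <= 1]. *)
rewrite /edit_dist_to; apply: (big_ind (fun k : nat => (c - gamma) * 'C(n, 2)%:R <= k%:R)).
- by rewrite card_ord ler_piMl ?ltW //; lra.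
- by move=> a b ha hb; rewrite /minn; case: ifP.
move=> G' G'f; have := GP G' G'f; rewrite -/c; have := double_bin2 R n.
have := mulr_ge0 (ltW pos) (ler0n R n).
rewrite expr2; set x : R := 'C(n, 2)%:R => h1 h2 h3.
have : (c - gamma) * (2 * x) = (c - gamma) * (n%:R * n%:R - n%:R) by rewrite h2.
lra.
Qed.

Lemma edit_ratio_cvg : (edit_ratio (Forb (K2 t)) p @ \oo --> c)%classic.
Proof.
apply/cvgrPdist_le => e e0; have [N HN] := edit_ratio_ge e0.
(* For [n >= 2] the binomial is at least [n / 2], so [n >= 2 / e] makes its inverse at most [e]. *)
exists (maxn N (maxn 2 (Num.truncn (2 / e)).+1)) => // n /=.
rewrite !geq_max => /and3P[Nn n2 ne].
have := HN n Nn; have := edit_ratio_le n2.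
have C0 : 0 < 'C(n, 2)%:R :> R by rewrite ltr0n bin_gt0.
have Ce : 'C(n, 2)%:R^-1 <= e.
  have : 2 / e <= n%:R.
    by apply: (@le_trans _ _ (Num.truncn (2 / e)).+1%:R); rewrite ?ler_nat //; apply/ltW/truncnS_gt.
  rewrite ler_pdivrMr // => h.
  have n2' : (2 : R) <= n%:R by rewrite ler_nat.
  have h2 := double_bin2 R n.
  have h3 : n%:R <= n%:R * n%:R - n%:R :> R by nra.
  rewrite -[leLHS]mul1r ler_pdivrMr //; nra.
by move=> h1 h2; rewrite ler_norml; apply/andP; split; lra.
Qed.

End Limit.

Theorem theorem5 (R : realType) (t : nat) (p : R) :
  (4 <= t)%N -> 0 <= p <= 1 -> 2 / (t%:R + 1) <= p ->
  cvgn (edit_ratio (Forb (K2 t)) p) /\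
  ed (Forb (K2 t)) p = (1 - p) / (t%:R - 1).
Proof.
move=> t4 p01 pt; have h := edit_ratio_cvg t4 p01 pt.
by split; [exact: cvgP h|exact: cvg_lim h].
Qed.
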